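(* Let $m\ge2$, let $w$ be a Sturmian or periodic (nonzero) infinite word over $\{0,1\}$, and let $A=A(m,w)$. Then the PI-exponent $exp(A^\sharp)$ exists and $$exp(A^\sharp)=1+exp(A)=1+\Phi_0(\beta),\qquad \beta=\frac{1}{m+\alpha},$$ where $\alpha$ is the slope of $w$.
   Context: Algebras are not necessarily associative over a field $F$ of characteristic $0$. For an algebra $R$, $c_n(R)=\dim P_n/(P_n\cap Id(R))$, where $P_n$ is the space of multilinear polynomials in $x_1,\dots,x_n$ of the absolutely free algebra and $Id(R)$ the ideal of identities of $R$; $exp(R)=\lim_{n\to\infty}\sqrt[n]{c_n(R)}$ when this limit exists. $\Phi_0(x)=\frac{1}{x^x(1-x)^{1-x}}$. The algebra $A(m,w)$: put $k_i=m+w_i$; basis $\{a,b\}\cup\{z^{(i)}_j: i\ge1,1\le j\le k_i\}$, products $z^{(i)}_ja=z^{(i)}_{j+1}$ ($1\le j\le k_i-1$), $z^{(i)}_{k_i}b=z^{(i+1)}_1$, all other products of basis elements zero. $A^\sharp$ is $A$ with an external unit adjoined. Sturmian: exactly $n+1$ distinct subwords of length $n$ for every $n$. Slope $\alpha=\pi(w)=\lim_n(w_1+\cdots+w_n)/n>0$. It is known that $exp(A(m,w))$ exists and equals $\Phi_0(\beta)$ with $\beta=1/(m+\alpha)$. *)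

(* Defs.v *)
From HB Require Import structures.
From mathcomp Require Import all_boot all_order all_algebra.
From Stdlib Require Import Reals.
Set Implicit Arguments.
Unset Strict Implicit.
Unset Printing Implicit Defensive.
Import GRing.Theory.

Inductive term : Type :=
| Var of nat
| Mul of term & term.

Fixpoint leaves (t : term) : seq nat :=
  match t with Var i => [:: i] | Mul a b => leaves a ++ leaves b end.

Definition multilinear (n : nat) (t : term) : bool := perm_eq (leaves t) (iota 0 n).

Section Codim.
Local Open Scope ring_scope.
Variables (F : fieldType) (V : lmodType F) (mul : V -> V -> V).

Fixpoint teval (s : nat -> V) (t : term) : V :=
  match t with Var i => s i | Mul a b => mul (teval s a) (teval s b) end.

Definition peval (f : seq (F * term)) (s : nat -> V) : V :=
  \sum_(c <- f) c.1 *: teval s c.2.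

Definition in_P (n : nat) (f : seq (F * term)) : bool :=
  all (fun c => multilinear n c.2) f.

Definition indep_mod_Id (k : nat) (f : 'I_k -> seq (F * term)) : Prop :=
  forall lam : 'I_k -> F,
    (forall s : nat -> V, \sum_(j < k) lam j *: peval (f j) s = 0) ->
    forall j, lam j = 0.

(* c = dim P_n / (P_n ∩ Id(R)) *)
Definition is_codim (n c : nat) : Prop :=
  (exists f : 'I_c -> seq (F * term), (forall j, in_P n (f j)) /\ indep_mod_Id f) /\
  (forall f : 'I_c.+1 -> seq (F * term), (forall j, in_P n (f j)) -> ~ indep_mod_Id f).
End Codim.

Definition nroot (n : nat) (x : R) : R := Rpower x (/ INR n).

Definition has_PIexp (F : fieldType) (V : lmodType F) (mul : V -> V -> V) (L : R) : Prop :=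
  exists c : nat -> nat, (forall n, is_codim mul n (c n)) /\
    Un_cv (fun n => nroot n (INR (c n))) L.

Definition Phi0 (x : R) : R := (/ (Rpower x x * Rpower (1 - x) (1 - x)))%R.

(* ---------- Infinite words over {0,1}: w_{i+1} = w i ---------- *)
Definition factor (w : nat -> bool) (i n : nat) : seq bool := mkseq (fun k => w (i + k)) n.

Definition complexity_is (w : nat -> bool) (n k : nat) : Prop :=
  exists s : seq (seq bool), uniq s /\ size s = k /\
    forall u, u \in s <-> exists i, u = factor w i n.

Definition sturmian (w : nat -> bool) : Prop := forall n, complexity_is w n n.+1.
Definition periodic (w : nat -> bool) : Prop := exists p, 0 < p /\ forall n, w (n + p) = w n.
Definition nonzero_word (w : nat -> bool) : Prop := exists n, w n = true.

Definition slope_is (w : nat -> bool) (alpha : R) : Prop :=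
  Un_cv (fun n => (INR (\sum_(l < n) (w l : nat)) / INR n)%R) alpha.

(* k_i = m + w_i ; K i = k_1 + ... + k_i *)
Definition Kpart (m : nat) (w : nat -> bool) (i : nat) : nat := \sum_(l < i) (m + w l).

(* The z's are enumerated linearly: z_0 = z^(1)_1, ..., z_{k_1-1} = z^(1)_{k_1},
   z_{k_1} = z^(2)_1, ...; blockend p <=> z_p = z^(i)_{k_i} for some i. *)
Definition blockend (m : nat) (w : nat -> bool) (p : nat) : bool :=
  has (fun i => Kpart m w i.+1 == p.+1) (iota 0 p.+1).

(* Basis of A(m,w): index 0 = a, 1 = b, 2 + p = z_p.  Product table on basis. *)
Definition tableA (m : nat) (w : nat -> bool) (i j : nat) : option nat :=
  if 2 <= i then
    (if (j == 0) && ~~ blockend m w (i - 2) then Some i.+1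
     else if (j == 1) && blockend m w (i - 2) then Some i.+1
     else None)
  else None.

(* Basis of A(m,w)^#: index 0 = external unit 1, i+1 = basis element i of A. *)
Definition tableAs (m : nat) (w : nat -> bool) (i j : nat) : option nat :=
  if i == 0 then Some j
  else if j == 0 then Some i
  else omap S (tableA m w i.-1 j.-1).

Section Tmul.
Local Open Scope ring_scope.
Definition bvec (F : fieldType) (o : option nat) : {poly F} :=
  if o is Some k then 'X^k else 0.

(* The algebra with basis (e_k)_k realised on {poly F} (e_k = 'X^k), with
   bilinear product given by the table on basis elements. *)
Definition tmul (F : fieldType) (tab : nat -> nat -> option nat) (p q : {poly F}) : {poly F} :=
  \sum_(i < size p) \sum_(j < size q) (p`_i * q`_j) *: bvec F (tab i j).
End Tmul.

(* Main.v *)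
Require Import Defs.
From HB Require Import structures.
From mathcomp Require Import all_boot all_order all_algebra.
From mathcomp Require Import zify Rstruct.
From Stdlib Require Import Reals Lra Lia Classical ClassicalEpsilon.
Set Implicit Arguments.
Unset Strict Implicit.
Unset Printing Implicit Defensive.
Import GRing.Theory.
Delimit Scope nat_scope with N.

(** Write [u] for the infinite word over {a,b} with [z_p u_p = z_(p+1)].  In [A]
    only left-normed monomials [x_i x_j1 x_j2 ...] survive, and their value is
    controlled by which variables receive [b]: the identities of degree [n] are
    cut out by the functionals indexed by a first variable, a factor [v] of [u]
    of length [n-1], and the set of variables sitting under the letters [b] of
    [v].  Hence [c_n(A)] is ['C(n, j)] up to a polynomial factor, where [j] is
    the number of [b]'s in a factor of length [n].  Setting a subset of the
    variables to 1 reduces [A^#] to [A] in lower degree, whence the upper bound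
    [c_n(A^#) <= poly * sum_k 'C(n, k) Phi_0(beta)^k = poly * (1 + Phi_0(beta))^n].
    For the lower bound, the commutators [[[x_i, x_j1], x_j2], ...] agree with
    the left-normed monomials on [A] and vanish when a variable is 1; multiplying
    them by the remaining variables gives ['C(n, k) 'C(k-1, j)] independent
    polynomials for each [k >= 2].  Finally, a Sturmian word is balanced, so [j]
    stays within a bounded distance of [beta n] for all factors simultaneously,
    and ['C(n, j)] is [Phi_0(beta)^n] up to a polynomial factor. *)

(** * Balance of Sturmian words *)

Definition same_factor (w : nat -> bool) (n i j : nat) : Prop :=
  forall k, k < n -> w (i + k) = w (j + k).

Lemma factorP w i j n : factor w i n = factor w j n <-> same_factor w n i j.
Proof.
split=> [E k kn|E].
  by rewrite -(nth_mkseq false (fun k => w (i + k)) kn) -/(factor w i n) E nth_mkseq.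
by apply/eq_in_map => k; rewrite mem_iota => /andP[_ kn]; apply: E.
Qed.

Lemma same_factor_sym w n i j : same_factor w n i j -> same_factor w n j i.
Proof. by move=> E k /E. Qed.

Lemma same_factor_trans w n i j k :
  same_factor w n i j -> same_factor w n j k -> same_factor w n i k.
Proof. by move=> E1 E2 l ln; rewrite E1 ?E2. Qed.

Lemma same_factor_head w n i j : same_factor w n.+1 i j -> w i = w j.
Proof. by move=> /(_ 0 isT); rewrite !addn0. Qed.

Lemma same_factor_tail w n i j :
  same_factor w n.+1 i j -> same_factor w n i.+1 j.+1.
Proof. by move=> E k kn; rewrite !addSnnS E. Qed.

Lemma same_factor_cons w n i j :
  w i = w j -> same_factor w n i.+1 j.+1 -> same_factor w n.+1 i j.
Proof. by move=> e E [|k] kn; rewrite ?addn0 // -!addSnnS E. Qed.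

Lemma same_factor_rcons w n i j :
  same_factor w n i j -> w (i + n) = w (j + n) -> same_factor w n.+1 i j.
Proof.
move=> E e k; rewrite ltnS leq_eqVlt => /orP[/eqP-> //|]; exact: E.
Qed.

(** The negation of being right special: the factor of length [n] at [x] has only one
    continuation. *)
Definition not_special (w : nat -> bool) (n x : nat) : Prop :=
  forall i j, same_factor w n i x -> same_factor w n j x -> w (i + n) = w (j + n).

(** There are n+2 factors of length n+1 and each of the n+1 factors of length n extends to one of
    them, so there is no room for two right special factors. In the proof one extension of each of
    two distinct special factors is removed; the n remaining words would still have all n+1 factors
    of length n among their prefixes. *)
Lemma sturmian_special_unique w n i1 i2 j1 j2 : sturmian w ->
  same_factor w n i1 i2 -> w (i1 + n) != w (i2 + n) ->
  same_factor w n j1 j2 -> w (j1 + n) != w (j2 + n) ->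
  same_factor w n i1 j1.
Proof.
move=> st Ei ni Ej nj; apply/factorP/eqP/negPn/negP => /eqP nE.
have [s [us [ss hs]]] := st n; have [s' [us' [ss' hs']]] := st n.+1.
have take_fac i : take n (factor w i n.+1) = factor w i n.
  by rewrite /factor /mkseq -map_take take_iota (minn_idPl (leqnSn n)).
have last_fac i : last false (factor w i n.+1) = w (i + n).
  by rewrite -nth_last size_mkseq nth_mkseq.
set s'' := rem (factor w j1 n.+1) (rem (factor w i1 n.+1) s').
have u1 := rem_uniq (factor w i1 n.+1) us'.
have mi : factor w i1 n.+1 \in s' by apply/hs'; exists i1.
have mj : factor w j1 n.+1 \in rem (factor w i1 n.+1) s'.
  rewrite mem_rem_uniq // inE; apply/andP; split; last by apply/hs'; exists j1.
  by apply/eqP => E; apply: nE; rewrite -!take_fac E.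
have sz : size s'' = n by rewrite /s'' size_rem // size_rem // ss'.
have : size s <= size (map (take n) s'').
  apply: uniq_leq_size => // v /hs [i ->].
  have key k : factor w k n = factor w i n -> factor w k n.+1 != factor w i1 n.+1 ->
     factor w k n.+1 != factor w j1 n.+1 -> factor w i n \in map (take n) s''.
    move=> <- n1 n2; rewrite -take_fac; apply: map_f.
    rewrite mem_rem_uniq // inE [in X in X && _]/= n2 /= mem_rem_uniq // inE n1; apply/hs'; by exists k.
  have [E1|n1] := eqVneq (factor w i n) (factor w i1 n).
    apply: (key i2).
    - by rewrite E1; apply/factorP/same_factor_sym.
    - by apply: contraNneq ni => E; rewrite -!last_fac E.
    - by apply/eqP => E; apply: nE; rewrite -(take_fac j1) -E take_fac; apply/factorP.
  have [E2|n2] := eqVneq (factor w i n) (factor w j1 n).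
    apply: (key j2).
    - by rewrite E2; apply/factorP/same_factor_sym.
    - apply/eqP => E; apply: nE; rewrite -(take_fac i1) -E take_fac.
      by apply/factorP/same_factor_sym.
    - by apply: contraNneq nj => E; rewrite -!last_fac E.
  by apply: (key i) => //; [apply: contraNneq n1|apply: contraNneq n2];
     move=> E; rewrite -!take_fac E.
by rewrite size_map sz ss ltnn.
Qed.

(** Any position can be lowered by multiples of [q] until it is below [a + q] without changing the
    factor there, so there are at most [a + q] factors of length [a + q], one too few. *)
Lemma eventually_periodic_not_sturmian w a q : 0 < q ->
  (forall i, a <= i -> w (i + q) = w i) -> ~ sturmian w.
Proof.
move=> q0 per st; have [s [us [ss hs]]] := st (a + q).
have : size s <= size [seq factor w i (a + q) | i <- iota 0 (a + q)].
  apply: uniq_leq_size => // v /hs [i ->].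
  elim/ltn_ind: i => i IH; case: (ltnP i (a + q)) => h.
    by apply: map_f; rewrite mem_iota.
  have -> : factor w i (a + q) = factor w (i - q) (a + q).
    apply/factorP => k _; rewrite -[RHS]per; last by lia.
    by congr w; lia.
  by apply: IH; lia.
by rewrite size_map size_iota ss ltnn.
Qed.

(** * Contradiction from factors b g b and b' g b' with b' the other letter and g a palindrome *)

Section Unbalanced.
Variables (w : nat -> bool) (b : bool) (x y L : nat).
Hypothesis st : sturmian w.
Hypotheses (wx : w x = b) (wxL : w (x + L.+1) = b).
Hypotheses (wy : w y = ~~ b) (wyL : w (y + L.+1) = ~~ b).
Hypothesis mid : same_factor w L x.+1 y.+1.
Hypothesis pal : forall k, k < L -> w (x.+1 + k) = w (x.+1 + (L.-1 - k)).
Hypothesis ns : not_special w L.+1 x.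

(* Writing [g] for the common middle factor, an occurrence of [~~b g] starting
   inside [b g b] would, [g] being a palindrome, give one letter two values. *)
Lemma window_neq s : s <= L.+1 -> ~ same_factor w L.+1 (x + s) y.
Proof.
move=> sL E; have hd := same_factor_head E.
case: s sL E hd => [|s] sL E hd; first by move: hd; rewrite addn0 wx wy; case: (b).
have [eL|neL] := eqVneq s L; first by move: hd; rewrite eL wxL wy; case: (b).
have sL' : s < L by lia.
have : w (x + s.+1 + (L - s)) = w (y + (L - s)) by apply: E; lia.
rewrite (_ : x + s.+1 + (L - s) = x + L.+1); last by lia.
rewrite wxL (_ : y + (L - s) = y.+1 + (L.-1 - s)); last by lia.
rewrite -mid; last by lia.
rewrite -pal // addSnnS hd wy; by case: (b).
Qed.

(** The suffix of length [L] of a right special factor is right special, hence equals the middle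
    factor g, which is followed by both letters. So a special window would be g preceded by [b] or
    by [~~ b]; [ns] rules out the first and [window_neq] the second. *)
Lemma window_not_special s : s <= L.+1 -> not_special w L.+1 (x + s).
Proof.
move=> sL i j Ei Ej; apply/eqP/negPn/negP => nE.
have T : same_factor w L i.+1 x.+1.
  apply: (@sturmian_special_unique w L i.+1 j.+1 x.+1 y.+1) => //.
  - by apply: same_factor_tail; apply: same_factor_trans Ei (same_factor_sym Ej).
  - by rewrite !addSnnS.
  - by rewrite !addSnnS wxL wyL; case: (b).
have [e|ne] := eqVneq (w i) b.
  have Ex : same_factor w L.+1 i x by apply: same_factor_cons; rewrite ?e ?wx.
  case/negP: nE; apply/eqP; apply: ns => //.
  by apply: same_factor_trans Ej _; apply: same_factor_trans (same_factor_sym Ei) _.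
apply: (window_neq sL).
apply: same_factor_trans (same_factor_sym Ei) _; apply: same_factor_cons.
  by rewrite wy; case: (w i) (b) ne => [] [].
exact: same_factor_trans T mid.
Qed.

(** The [L.+2] windows of length [L.+1] starting inside b g b all miss one of the [L.+2] factors of
    that length, so two of them coincide. As none is special, the letters that follow are forced,
    and the word is eventually periodic. *)
Lemma unbalanced_false : False.
Proof.
have [fs [ufs [sfs hfs]]] := st L.+1.
pose ws := [seq factor w (x + s) L.+1 | s <- iota 0 L.+2].
have nu : ~~ uniq ws.
  apply/negP => u.
  have : size ws <= size (rem (factor w y L.+1) fs).
    apply: uniq_leq_size => // v /mapP[s]; rewrite mem_iota => /andP[_ sL] ->.
    rewrite mem_rem_uniq // inE; apply/andP; split; last by apply/hfs; exists (x + s).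
    by apply/eqP => /factorP; apply: window_neq; lia.
  rewrite size_rem; last by apply/hfs; exists y.
  by rewrite sfs size_map size_iota /= ltnn.
have [s [s' [ss' s'L]]] := uniqPn [::] nu.
rewrite size_map size_iota in s'L.
rewrite !(nth_map 0) ?size_iota ?nth_iota; try lia.
rewrite !add0n => /factorP Q0.
(* The coincidence propagates to the right as long as the windows are not special. Beyond the
   original range of windows, non-speciality is inherited from the equal window [s' - s] places
   earlier. *)
have all t : same_factor w L.+1 (x + s + t) (x + s' + t) /\
             not_special w L.+1 (x + s + t).
  elim/ltn_ind: t => t IH.
  have Q : same_factor w L.+1 (x + s + t) (x + s' + t).
    case: t IH => [|t] IH; first by rewrite !addn0.
    have [//|Qt NSt] := IH t.
    rewrite !addnS; apply: (@same_factor_tail _ L.+1); apply: same_factor_rcons => //.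
    by apply: NSt => //; apply: same_factor_sym.
  split=> //; case: (leqP (s + t) L.+1) => h.
    by rewrite -addnA; apply: window_not_special.
  have [|Qt NSt] := IH (t - (s' - s)); first by lia.
  have e : x + s' + (t - (s' - s)) = x + s + t by lia.
  rewrite e in Qt.
  by move=> i j Ei Ej; apply: NSt; apply: same_factor_trans (same_factor_sym Qt).
apply: (@eventually_periodic_not_sturmian w (x + s) (s' - s)) => //; first by lia.
move=> i hi; have [/same_factor_head E _] := all (i - (x + s)).
rewrite (_ : x + s + _ = i) in E; last by lia.
by rewrite E; congr w; lia.
Qed.
End Unbalanced.

Definition wcount (w : nat -> bool) (i n : nat) : nat := \sum_(k < n) w (i + k).

Lemma wcountD w i r s : wcount w i (r + s) = wcount w i r + wcount w (i + r) s.
Proof.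
rewrite /wcount big_split_ord /=; congr (_ + _).
by apply: eq_bigr => k _; rewrite addnA.
Qed.

Lemma wcount1 w i : wcount w i 1 = w i.
Proof. by rewrite /wcount big_ord1 addn0. Qed.

Lemma wcount0 w i : wcount w i 0 = 0.
Proof. by rewrite /wcount big_ord0. Qed.

Lemma wcountS w i n : wcount w i n.+1 = wcount w i n + w (i + n).
Proof. by rewrite -addn1 wcountD wcount1. Qed.

Lemma wcountSl w i n : wcount w i n.+1 = w i + wcount w i.+1 n.
Proof. by rewrite -add1n wcountD wcount1 addn1. Qed.

Lemma wcount_le w i n : wcount w i n <= n.
Proof. by elim: n => [|n IH]; rewrite ?wcount0 ?wcountS //; case: (w _); lia. Qed.

(** In a violation of minimal length, the two factors must be 1g1 and 0g0 with g a palindrome. By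
    uniqueness of the right special factor, 1g and 0g are not both special; the one that is not
    special plays the role of [b g] in [unbalanced_false]. *)
Lemma sturmian_balanced w n i j :
  sturmian w -> wcount w i n <= (wcount w j n).+1.
Proof.
move=> st; elim/ltn_ind: n i j => n IH x y; rewrite leqNgt; apply/negP => d.
(* By minimality both the prefix and the complementary suffix contribute at most 1 to a difference
   of at least 2, so each proper prefix contributes exactly 1. *)
have d1 r : 0 < r < n -> wcount w x r = (wcount w y r).+1.
  move=> /andP[r0 rn]; have := IH r rn x y; have := IH (n - r) _ (x + r) (y + r).
  have e : n = r + (n - r) by lia.
  by move: d; rewrite {1 2}e !wcountD => d h; have := h ltac:(lia); lia.
have n2 : 1 < n by have := wcount_le w x n; lia.
case: n IH d d1 n2 => [//|[//|L]] IH d d1 _.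
have := d1 1 isT; rewrite !wcount1 => e1.
have [wx wy] : w x = true /\ w y = false by case: (w x) (w y) e1 => [] [].
have := d1 L.+1 ltac:(lia) => eL; move: (d); rewrite !(wcountS _ _ L.+1) eL => dd.
have [wxL wyL] : w (x + L.+1) = true /\ w (y + L.+1) = false.
  by case: (w (x + _)) (w (y + _)) dd => [] [] //= dd; exfalso; lia.
have mid : same_factor w L x.+1 y.+1.
  move=> k kL; have := d1 k.+2 ltac:(lia); have := d1 k.+1 ltac:(lia).
  by rewrite !(wcountS _ _ k.+1) !addSnnS; case: (w (x + _)) (w (y + _)) => [] [] //=; lia.
have midc i r : i + r <= L -> wcount w (x.+1 + i) r = wcount w (y.+1 + i) r.
  move=> h; apply: eq_bigr => k _; congr nat_of_bool; rewrite -!addnA; apply: mid.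
  by have := ltn_ord k; lia.
(* prefixes of [1g] against suffixes of [g0], and prefixes of [0g] against suffixes of [g1] *)
have pc r : r <= L -> wcount w x.+1 r = wcount w (x.+1 + (L - r)) r.
  move=> rL.
  have := IH r.+1 ltac:(lia) x (y.+1 + (L - r)).
  have := IH r.+1 ltac:(lia) (x.+1 + (L - r)) y.
  rewrite (wcountSl _ x) (wcountSl _ y) wx wy !wcountS.
  rewrite -[in y.+1 + (L - r) + r]addnA -[in x.+1 + (L - r) + r]addnA subnK //.
  rewrite !(addSnnS _ L) wxL wyL -midc ?subnK //.
  have := midc 0 r ltac:(lia); rewrite !addn0 => <-; lia.
have pal k : k < L -> w (x.+1 + k) = w (x.+1 + (L.-1 - k)).
  move=> kL; have := pc k ltac:(lia); have := pc k.+1 ltac:(lia).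
  rewrite wcountS (_ : L - k.+1 = L.-1 - k); last by lia.
  rewrite wcountSl (_ : (x.+1 + (L.-1 - k)).+1 = x.+1 + (L - k)); last by lia.
  by case: (w (x.+1 + k)) (w _) => [] [] //=; lia.
have [ns|sp] := classic (not_special w L.+1 x).
  exact: (@unbalanced_false w true x y L).
apply: (@unbalanced_false w false y x L) => //.
- exact: same_factor_sym.
- move=> k kL; have kL' : L.-1 - k < L by lia.
  by rewrite -(mid _ kL) -(mid _ kL'); apply: pal.
move=> i j Ei Ej; apply/eqP/negPn/negP => nE; apply: sp => i' j' Ei' Ej'.
apply/eqP/negPn/negP => nE'.
suff /same_factor_head : same_factor w L.+1 x y by rewrite wx wy.
have Exy : same_factor w L.+1 i' i.
  apply: (@sturmian_special_unique _ _ i' j' i j) => //.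
    exact: same_factor_trans Ei' (same_factor_sym Ej').
  exact: same_factor_trans Ei (same_factor_sym Ej).
by apply: same_factor_trans (same_factor_sym Ei') _; apply: same_factor_trans Exy Ei.
Qed.

(** All windows of length [p] contain the same number of ones, so whole periods cancel and only a
    remainder shorter than [p] contributes. *)
Lemma periodic_balanced w : periodic w ->
  exists D, forall n i j, wcount w i n <= wcount w j n + D.
Proof.
move=> [p [p0 per]]; exists p.
have sh n i : wcount w (i + p) n = wcount w i n.
  by apply: eq_bigr => k _; rewrite addnAC per.
have full i : wcount w i p = wcount w 0 p.
  elim: i => // i <-; apply/eqP.
  by rewrite -(eqn_add2l (w i)) -wcountSl wcountS per addnC.
elim/ltn_ind => n IH i j; case: (ltnP n p) => h.
  by have := wcount_le w i n; lia.
have e : n = p + (n - p) by lia.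
rewrite e !wcountD !sh !(full i, full j).
by have := IH (n - p) ltac:(lia) i j; lia.
Qed.

(** * Finite sets of positions representing all factors *)

Lemma representatives (T : eqType) (g : nat -> T) (s : seq T) :
  (forall v, v \in s -> exists i, v = g i) ->
  exists s' : seq nat, s = map g s'.
Proof.
elim: s => [|v s IH] h; first by exists [::].
have [s' ->] := IH (fun u us => h u (mem_behead (s := v :: s) us)).
by have [i ->] := h v (mem_head v s); exists (i :: s').
Qed.

(** Factors are represented by positions because a functional on the algebra is specified by the
    index of the [z_p] from which reading starts. *)
Definition covers_factors (w : nat -> bool) (n : nat) (s : seq nat) : Prop :=
  forall i, exists2 j, j \in s & same_factor w n i j.

Lemma sturmian_representatives w : sturmian w ->
  forall n, exists s, size s <= n.+1 /\ covers_factors w n s.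
Proof.
move=> st n; have [s [_ [ss hs]]] := st n.
have [s' es] : exists s', s = [seq factor w i n | i <- s'].
  by apply: representatives => v /hs.
exists s'; split=> [|i]; first by rewrite -ss es size_map.
have : factor w i n \in s by apply/hs; exists i.
by rewrite es => /mapP[j js /factorP]; exists j.
Qed.

Lemma periodic_representatives w : periodic w ->
  exists p, forall n, exists s, size s <= p /\ covers_factors w n s.
Proof.
move=> [p [p0 per]]; exists p => n; exists (iota 0 p).
split=> [|i]; first by rewrite size_iota.
elim/ltn_ind: i => i IH; case: (ltnP i p) => h; first by exists i; rewrite ?mem_iota.
have [j js E] := IH (i - p) ltac:(lia); exists j => // k kn.
rewrite -E // -[RHS]per; congr w; lia.
Qed.

(** * The word of block ends *)

Section Blocks.
Variables (m : nat) (w : nat -> bool).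
Hypothesis m2 : 2 <= m.
Notation K := (Kpart m w).
Notation u := (blockend m w).

Lemma KpartS i : K i.+1 = K i + (m + w i).
Proof. by rewrite /Kpart big_ord_recr. Qed.

Lemma KpartD i r : K (i + r) = K i + (m * r + wcount w i r).
Proof.
elim: r => [|r IH]; first by rewrite wcount0 muln0 !addn0.
by rewrite addnS KpartS IH wcountS; lia.
Qed.

Lemma Kpart_lt i j : i < j -> K i < K j.
Proof. by move=> ij; rewrite -(subnKC ij) addSnnS KpartD; nia. Qed.

Lemma Kpart_ltE i j : (K i < K j) = (i < j).
Proof.
apply/idP/idP => [|/Kpart_lt //]; apply: contraLR; rewrite -!leqNgt leq_eqVlt.
by move=> /orP[/eqP-> //|/Kpart_lt/ltnW].
Qed.

Lemma blockendP p : reflect (exists i, K i.+1 = p.+1) (u p).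
Proof.
apply: (iffP hasP) => [[i _ /eqP]|[i e]]; first by exists i.
exists i; last by apply/eqP.
have := KpartD 0 i.+1; rewrite add0n {2}/Kpart big_ord0 e mem_iota; nia.
Qed.

Definition bcount (q : nat) : nat := \sum_(r < q) u r.

Lemma bcountS q : bcount q.+1 = bcount q + u q.
Proof. by rewrite /bcount big_ord_recr. Qed.

(** The number of block ends before [q] is the index, from 0, of the block containing [z_q]. This
    inverts [Kpart] and converts statements about [w] into statements about the word of block
    ends. *)
Lemma bcount_bounds q : K (bcount q) <= q < K (bcount q).+1.
Proof.
elim: q => [|q /andP[IH1 IH2]].
  by rewrite /bcount /Kpart !big_ord0 big_ord1; lia.
rewrite bcountS; case: blockendP => [[i e]|n]; last first.
  rewrite addn0 (leq_trans IH1) //= ltn_neqAle IH2 andbT.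
  by apply/eqP => e; apply: n; exists (bcount q).
rewrite addn1; have := Kpart_ltE (bcount q) i.+1; rewrite e ltnS IH1 => /esym h.
have E : K (bcount q).+1 = q.+1.
  apply/eqP; rewrite eqn_leq IH2 andbT -e leqNgt Kpart_ltE; lia.
by rewrite E leqnn -[X in X < _]E Kpart_ltE ltnSn.
Qed.

Lemma bcountD p l : exists d, bcount (p + l) = bcount p + d.
Proof.
exists (\sum_(r < l) u (p + r)).
by rewrite /bcount big_split_ord.
Qed.

Lemma same_factor_bcount n p p' l : same_factor u n p p' -> l <= n ->
  bcount (p + l) - bcount p = bcount (p' + l) - bcount p'.
Proof.
move=> E ln; rewrite /bcount !big_split_ord /= !addKn.
by apply: eq_bigr => r _; rewrite E //; apply: leq_trans ln.
Qed.

(** Counted from the start of a block, the later block ends depend only on the letters of [w] from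
    that block on. Blocks are nonempty, so at most x+1 of them end within the first x+1 places, and
    [n] letters of [w] suffice. *)
Lemma blockend_shift i i' n x : same_factor w n i i' -> x < n ->
  u (K i + x) = u (K i' + x).
Proof.
suff imp j j' : same_factor w n j j' -> x < n -> u (K j + x) -> u (K j' + x).
  move=> E xn; apply/idP/idP; apply: imp => //; exact: same_factor_sym.
move=> E xn /blockendP[k e].
have jk : j < k.+1 by rewrite -Kpart_ltE e; lia.
pose r := k.+1 - j; have er : k.+1 = j + r by rewrite /r; lia.
rewrite er KpartD in e.
have rx : r <= x.+1 by nia.
apply/blockendP; exists (j' + r.-1).
have -> : (j' + r.-1).+1 = j' + r by lia.
rewrite KpartD -addnS -[RHS]/(K j' + x.+1); congr (_ + _).
have <- : wcount w j r = wcount w j' r.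
  by apply: eq_bigr => s _; rewrite E //; have := ltn_ord s; lia.
lia.
Qed.

(** A position is a block index together with an offset of at most [m] into the block, so each
    factor of [w] yields at most m+1 factors of the word of block ends. The length [(n + m).+1]
    absorbs the offset. *)
Lemma blockend_representatives n s : covers_factors w (n + m).+1 s ->
  exists s', size s' = size s * m.+1 /\ covers_factors u n s'.
Proof.
move=> cov; exists [seq K i + o | i <- s, o <- iota 0 m.+1].
rewrite size_allpairs size_iota; split=> // p.
have /andP[h1 h2] := bcount_bounds p; set i := bcount p in h1 h2.
have [i' i's E] := cov i; pose o := p - K i.
have om : o <= m by move: h2; rewrite KpartS /o; case: (w i); lia.
exists (K i' + o).
  by apply: allpairs_f => //; rewrite mem_iota.
move=> k kn; rewrite -addnA -(blockend_shift E); last by lia.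
by congr u; rewrite /o; lia.
Qed.

End Blocks.

(** * Codimensions *)

Fixpoint term_eq (s t : term) : bool :=
  match s, t with
  | Var i, Var j => i == j
  | Mul a b, Mul c d => term_eq a c && term_eq b d
  | _, _ => false
  end.

Lemma term_eqP : Equality.axiom term_eq.
Proof.
elim=> [i|a IHa b IHb] [j|c d] /=; try by constructor.
  by apply: (iffP eqP) => [->|[]].
by apply: (iffP andP) => [[/IHa -> /IHb ->]|[<- <-]] //; split; [apply/IHa|apply/IHb].
Qed.

HB.instance Definition _ := hasDecEq.Build term term_eqP.

Section Codimension.
Local Open Scope ring_scope.
Variables (F : fieldType) (V : lmodType F) (mul : V -> V -> V) (n : nat).

Definition has_indep (k : nat) : Prop :=
  exists f : 'I_k -> seq (F * term), (forall j, in_P n (f j)) /\ indep_mod_Id mul f.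

Lemma has_indep_pred k : has_indep k.+1 -> has_indep k.
Proof.
move=> [f [fP fi]]; exists (fun i => f (lift ord_max i)); split=> // lam H i.
pose lam' j := oapp lam 0 (unlift ord_max j).
have e j : lam' (lift ord_max j) = lam j by rewrite /lam' liftK.
rewrite -e; apply: fi => s; rewrite (bigD1_ord ord_max) //= {1}/lam' unlift_none.
rewrite scale0r add0r -[RHS](H s).
by apply: eq_bigr => j _; rewrite e.
Qed.

(** The sizes of independent families are closed downwards, so a largest size exists as soon as one
    bound is known. *)
Lemma is_codim_exists L U : has_indep L -> ~ has_indep U.+1 ->
  exists c, [/\ is_codim mul n c, (L <= c)%N & (c <= U)%N].
Proof.
move=> HL HU.
have LU : (L <= U)%N.
  rewrite leqNgt; apply/negP => /subnKC UL; apply: HU.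
  move: (L - U.+1)%N UL => d; elim: d L HL => [|d IH] L HL E; first by rewrite addn0 in E; rewrite E.
  apply: (IH L.-1); last by rewrite -E addnS.
  by apply: has_indep_pred; rewrite -E addnS /= in HL *.
suff [c [Lc cU Hc Hc']] : exists c, [/\ (L <= c)%N, (c <= U)%N, has_indep c & ~ has_indep c.+1].
  by exists c; split=> //; split=> // f fP fi; apply: Hc'; exists f.
elim: U HU LU => [|U IH] HU LU; first by move: LU HL; rewrite leqn0 => /eqP -> HL; exists 0%N.
have [h|h] := classic (has_indep U.+1); first by exists U.+1.
move: LU; rewrite leq_eqVlt => /orP[/eqP e|LU]; first by rewrite e in HL.
by have [c [? ? ? ?]] := IH h LU; exists c; split=> //; apply: leqW.
Qed.

(** Evaluating a vanishing combination at [g j'] leaves only the term of [j'], so its coefficient is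
    zero. *)
Lemma has_indep_dual (J : eqType) (js : seq J) (f : J -> seq (F * term)) (g : J -> nat -> V) :
  uniq js -> (forall j, j \in js -> in_P n (f j)) ->
  {in js &, forall j j', (peval mul (f j) (g j') == 0) = (j != j')} ->
  has_indep (size js).
Proof.
move=> ujs fP H; pose t := in_tuple js.
exists (fun i => f (tnth t i)); split=> [i|lam Hl i]; first by apply: fP; rewrite mem_tnth.
have := Hl (g (tnth t i)); rewrite (bigD1 i) //= big1 ?addr0 => [/eqP|j ji].
  by rewrite scaler_eq0 H ?mem_tnth // eqxx orbF => /eqP.
apply/eqP; rewrite scaler_eq0 H ?mem_tnth // (inj_eq (tuple_uniqP t ujs)) ji orbT //.
Qed.

(** One polynomial [h] serves for every [phi] at once: it is used both with evaluation in the
    algebra and with scalar functionals on monomials. *)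
Lemma in_P_comb k (lam : 'I_k -> F) (f : 'I_k -> seq (F * term)) :
  (forall j, in_P n (f j)) -> exists2 h, in_P n h &
    forall (W : lmodType F) (phi : term -> W), \sum_(c <- h) c.1 *: phi c.2 =
      \sum_(j < k) lam j *: \sum_(c <- f j) c.1 *: phi c.2.
Proof.
move=> fP; exists (flatten [seq [seq (lam j * c.1, c.2) | c <- f j] | j <- enum 'I_k]).
  apply/allP => c /flatten_mapP[j _ /mapP[c' cf ->]] /=; exact: (allP (fP j)).
move=> W phi; rewrite big_flatten big_map big_enum; apply: eq_bigr => j _.
by rewrite big_map scaler_sumr; apply: eq_bigr => c _; rewrite scalerA.
Qed.

Hypothesis mulPl : forall c x y z, mul (c *: x + y) z = c *: mul x z + mul y z.
Hypothesis mulPr : forall c x y z, mul z (c *: x + y) = c *: mul z x + mul z y.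

Lemma bilin0l z : mul 0 z = 0.
Proof.
have := mulPl 1 0 0 z; rewrite !scale1r addr0 => /eqP.
by rewrite -subr_eq subrr eq_sym => /eqP.
Qed.

Lemma bilin0r z : mul z 0 = 0.
Proof.
have := mulPr 1 0 0 z; rewrite !scale1r addr0 => /eqP.
by rewrite -subr_eq subrr eq_sym => /eqP.
Qed.

Lemma teval_ext s s' t : {in leaves t, s =1 s'} -> teval mul s t = teval mul s' t.
Proof.
elim: t => [i|a IHa b IHb] /= H; first by apply: H; rewrite mem_head.
by rewrite IHa ?IHb // => i it; apply: H; rewrite mem_cat it ?orbT.
Qed.

Definition upd (s : nat -> V) (r : nat) (x : V) i := if i == r then x else s i.

Lemma teval_upd_notin s r x t : r \notin leaves t -> teval mul (upd s r x) t = teval mul s t.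
Proof.
move=> rt; apply: teval_ext => i it; rewrite /upd; case: eqP => // e.
by rewrite e (negbTE rt) in it.
Qed.

Lemma teval_linear s r t c x y : uniq (leaves t) -> r \in leaves t ->
  teval mul (upd s r (c *: x + y)) t =
  c *: teval mul (upd s r x) t + teval mul (upd s r y) t.
Proof.
elim: t => [i|a IHa b IHb] /=; first by rewrite inE /upd eq_sym => _ ->.
rewrite cat_uniq mem_cat => /and3P[ua dis ub] rab.
have [ra|ra] := boolP (r \in leaves a).
  have rb : r \notin leaves b by apply: contra dis => rb; apply/hasP; exists r.
  by rewrite IHa // !(teval_upd_notin _ _ rb) mulPl.
rewrite (negbTE ra) in rab.
by rewrite IHb // !(teval_upd_notin _ _ ra) mulPr.
Qed.

Lemma multilinear_uniq t : multilinear n t -> uniq (leaves t).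
Proof. by move=> /perm_uniq ->; rewrite iota_uniq. Qed.

Lemma multilinear_mem t i : multilinear n t -> (i \in leaves t) = (i < n)%N.
Proof. by move=> /perm_mem ->; rewrite mem_iota. Qed.

Lemma peval_linear f s r c x y : in_P n f -> (r < n)%N ->
  peval mul f (upd s r (c *: x + y)) =
  c *: peval mul f (upd s r x) + peval mul f (upd s r y).
Proof.
move=> /allP fP rn; rewrite /peval scaler_sumr -big_split /=.
apply: eq_big_seq => d /fP dP.
rewrite teval_linear ?(multilinear_uniq dP) ?(multilinear_mem _ dP) //.
by rewrite scalerDr !scalerA mulrC.
Qed.

Lemma peval_ext f s s' : in_P n f -> (forall i, (i < n)%N -> s i = s' i) ->
  peval mul f s = peval mul f s'.
Proof.
move=> /allP fP e; apply: eq_big_seq => d /fP dP; congr (_ *: _).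
by apply: teval_ext => i; rewrite (multilinear_mem _ dP) => /e.
Qed.

Definition pcomm (f : seq (F * term)) (y : nat) : seq (F * term) :=
  [seq (c.1, Mul c.2 (Var y)) | c <- f] ++ [seq (- c.1, Mul (Var y) c.2) | c <- f].

Definition pmulr (f : seq (F * term)) (y : nat) : seq (F * term) :=
  [seq (c.1, Mul c.2 (Var y)) | c <- f].

Lemma peval_pmulr f y s : peval mul (pmulr f y) s = mul (peval mul f s) (s y).
Proof.
rewrite /peval big_map; elim: f => [|c f IH]; first by rewrite !big_nil bilin0l.
by rewrite !big_cons IH mulPl.
Qed.

Lemma peval_pcomm f y s :
  peval mul (pcomm f y) s = mul (peval mul f s) (s y) - mul (s y) (peval mul f s).
Proof.
rewrite -peval_pmulr /peval big_cat /=; congr (_ + _).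
rewrite big_map; elim: f => [|c f IH]; first by rewrite !big_nil bilin0r oppr0.
by rewrite !big_cons IH mulPr opprD scaleNr.
Qed.

Definition leaves_perm (l : seq nat) (f : seq (F * term)) : bool :=
  all (fun c => perm_eq (leaves c.2) l) f.

Lemma leaves_perm_pmulr l f y : leaves_perm l f -> leaves_perm (rcons l y) (pmulr f y).
Proof.
move=> /allP H; apply/allP => c /mapP[d /H df ->] /=.
by rewrite -cats1 perm_cat2r.
Qed.

Lemma leaves_perm_pcomm l f y : leaves_perm l f -> leaves_perm (rcons l y) (pcomm f y).
Proof.
move=> H; rewrite /leaves_perm all_cat; apply/andP; split; first exact: leaves_perm_pmulr.
apply/allP => c /mapP[d /(allP H) df ->] /=.
by rewrite perm_sym perm_rcons /= perm_cons perm_sym.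
Qed.

Definition nested_comm (i : nat) (ys ts : seq nat) : seq (F * term) :=
  foldl pmulr (foldl pcomm [:: (1, Var i)] ys) ts.

Lemma leaves_perm_nested i ys ts : leaves_perm (i :: ys ++ ts) (nested_comm i ys ts).
Proof.
have H1 zs l f : leaves_perm l f -> leaves_perm (l ++ zs) (foldl pcomm f zs).
  elim: zs l f => [|z zs IH] l f H; rewrite ?cats0 //=.
  by rewrite -cat_rcons; apply: IH; apply: leaves_perm_pcomm.
have H2 zs l f : leaves_perm l f -> leaves_perm (l ++ zs) (foldl pmulr f zs).
  elim: zs l f => [|z zs IH] l f H; rewrite ?cats0 //=.
  by rewrite -cat_rcons; apply: IH; apply: leaves_perm_pmulr.
by rewrite -cat_cons; apply: H2; rewrite -cat1s; apply: H1; rewrite /leaves_perm /= perm_refl.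
Qed.

Lemma in_P_nested i ys ts : perm_eq (i :: ys ++ ts) (iota 0 n) ->
  in_P n (nested_comm i ys ts).
Proof.
move=> E; apply/allP => c /(allP (leaves_perm_nested i ys ts)) H.
exact: perm_trans H E.
Qed.

Lemma peval_Var i s : peval mul [:: (1, Var i)] s = s i.
Proof. by rewrite /peval big_seq1 scale1r. Qed.

Lemma foldl_pmulr_eq0 f ts s : peval mul f s = 0 -> peval mul (foldl pmulr f ts) s = 0.
Proof. by elim: ts f => //= t ts IH f e; apply: IH; rewrite peval_pmulr e bilin0l. Qed.

Lemma foldl_pcomm_eq0 f ts s : peval mul f s = 0 -> peval mul (foldl pcomm f ts) s = 0.
Proof.
elim: ts f => //= t ts IH f e; apply: IH.
by rewrite peval_pcomm e bilin0l bilin0r subrr.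
Qed.

(** A commutator with the unit is zero, and zero persists under further commutators and products.
    Nonemptiness of [ys] is what puts [x_i] itself inside a commutator. *)
Lemma nested_comm_unit one i ys ts s :
  (forall x, mul one x = x) -> (forall x, mul x one = x) -> ys != [::] ->
  (exists2 y, y \in i :: ys & s y = one) -> peval mul (nested_comm i ys ts) s = 0.
Proof.
move=> H1l H1r ysn [y]; rewrite inE => /orP[/eqP->|yys] e; apply: foldl_pmulr_eq0.
  case: ys ysn => //= z zs _; apply: foldl_pcomm_eq0.
  by rewrite peval_pcomm peval_Var e H1l H1r subrr.
have /path.splitPr[p1 p2] := yys; rewrite foldl_cat /=; apply: foldl_pcomm_eq0.
by rewrite peval_pcomm e H1l H1r subrr.
Qed.

Lemma foldl_pmulr_unit one f ts s : (forall x, mul x one = x) ->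
  {in ts, forall t, s t = one} -> peval mul (foldl pmulr f ts) s = peval mul f s.
Proof.
move=> H1r; elim: ts f => //= t ts IH f H; rewrite IH; last first.
  by move=> i it; apply: H; rewrite inE it orbT.
by rewrite peval_pmulr H ?mem_head // H1r.
Qed.

End Codimension.

(** * Algebras given by a multiplication table *)

Fixpoint tabeval (tab : nat -> nat -> option nat) (e : nat -> nat) (t : term) : option nat :=
  match t with
  | Var i => Some (e i)
  | Mul a b => obind (fun i => obind (tab i) (tabeval tab e b)) (tabeval tab e a)
  end.

Lemma tabeval_ext tab e e' t : {in leaves t, e =1 e'} -> tabeval tab e t = tabeval tab e' t.
Proof.
elim: t => [i|a IHa b IHb] /= H; first by rewrite H ?mem_head.
by rewrite IHa ?IHb // => i it; apply: H; rewrite mem_cat it ?orbT.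
Qed.

(** A grading of the table gives every nonzero product the sum of the degrees of its factors,
    whatever the bracketing. *)
Lemma tabeval_additive tab (g : nat -> nat) e t k :
  (forall i j l, tab i j = Some l -> g l = g i + g j) ->
  tabeval tab e t = Some k -> g k = \sum_(i <- leaves t) g (e i).
Proof.
move=> gD; elim: t k => [i|a IHa b IHb] k /=; first by move=> [<-]; rewrite big_seq1.
rewrite big_cat /=; case: (tabeval tab e a) IHa => //= x /(_ x erefl) <-.
by case: (tabeval tab e b) IHb => //= y /(_ y erefl) <- /gD.
Qed.

Section TableAlgebra.
Local Open Scope ring_scope.
Variables (F : fieldType) (tab : nat -> nat -> option nat).
Notation mul := (@tmul F tab).

Lemma big_ord_supp (V : nmodType) (f : nat -> V) k l :
  (k <= l)%N -> (forall i, (k <= i)%N -> f i = 0) -> \sum_(i < k) f i = \sum_(i < l) f i.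
Proof.
move=> kl f0; rewrite (big_ord_widen l f kl) big_mkcond; apply: eq_bigr => i _.
by case: ltnP => // /f0.
Qed.

(** The ranges of summation in [tmul] depend on the sizes of the arguments; padding them to a common
    range is what allows linearity to be checked termwise. *)
Lemma tmulE (p q : {poly F}) k l : (size p <= k)%N -> (size q <= l)%N ->
  mul p q = \sum_(i < k) \sum_(j < l) (p`_i * q`_j) *: bvec F (tab i j).
Proof.
move=> pk ql; rewrite /tmul.
rewrite (big_ord_supp (f := fun i => \sum_(j < size q) (p`_i * q`_j) *: bvec F (tab i j)) pk).
  apply: eq_bigr => i _.
  apply: (big_ord_supp (f := fun j => (p`_i * q`_j) *: bvec F (tab i j)) ql) => j qj.
  by rewrite (nth_default _ qj) mulr0 scale0r.
by move=> i pi; apply: big1 => j _; rewrite (nth_default _ pi) mul0r scale0r.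
Qed.

Lemma tmulPl c x y z : mul (c *: x + y) z = c *: mul x z + mul y z.
Proof.
pose k := maxn (size (c *: x + y)) (maxn (size x) (size y)).
rewrite !(@tmulE _ z k (size z)) ?leq_max ?leqnn ?orbT //.
rewrite scaler_sumr -big_split; apply: eq_bigr => i _ /=.
rewrite scaler_sumr -big_split; apply: eq_bigr => j _ /=.
by rewrite coefD coefZ mulrDl scalerDl -mulrA scalerA.
Qed.

Lemma tmulPr c x y z : mul z (c *: x + y) = c *: mul z x + mul z y.
Proof.
pose k := maxn (size (c *: x + y)) (maxn (size x) (size y)).
rewrite !(@tmulE z _ (size z) k) ?leq_max ?leqnn ?orbT //.
rewrite scaler_sumr -big_split; apply: eq_bigr => i _ /=.
rewrite scaler_sumr -big_split; apply: eq_bigr => j _ /=.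
by rewrite coefD coefZ mulrDr scalerDl mulrCA scalerA.
Qed.

Lemma tmul_monomial i j : mul 'X^i 'X^j = bvec F (tab i j).
Proof.
rewrite (@tmulE _ _ i.+1 j.+1) ?size_polyXn //.
rewrite big_ord_recr big1 /= ?add0r => [|k _].
  rewrite big_ord_recr big1 /= ?add0r => [|k _].
    by rewrite !coefXn !eqxx mulr1 scale1r.
  by rewrite !coefXn (ltn_eqF (ltn_ord k)) mulr0 scale0r.
by apply: big1 => l _; rewrite !coefXn (ltn_eqF (ltn_ord k)) mul0r scale0r.
Qed.

Lemma poly_linear_eq0 (g : {poly F} -> {poly F}) :
  (forall c x y, g (c *: x + y) = c *: g x + g y) -> (forall k, g 'X^k = 0) ->
  forall p, g p = 0.
Proof.
move=> gP gX p.
have g0 : g 0 = 0.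
  have := gP 1 0 0; rewrite !scale1r addr0 => /eqP.
  by rewrite -subr_eq subrr eq_sym => /eqP.
rewrite -[p]coefK poly_def; elim/big_ind: _ => [//|x y x0 y0|i _].
  by have := gP 1 x y; rewrite !scale1r x0 y0 addr0.
by have := gP p`_i 'X^i 0; rewrite !addr0 gX g0 scaler0 addr0.
Qed.

Definition basis_subst (e : nat -> nat) (i : nat) : {poly F} := 'X^(e i).

Lemma teval_basis e t : teval mul (basis_subst e) t = bvec F (tabeval tab e t).
Proof.
elim: t => [i|a IHa b IHb] //=; rewrite IHa IHb.
case: (tabeval tab e a) => [x|] /=; last exact: (bilin0l tmulPl).
case: (tabeval tab e b) => [y|] /=; last exact: (bilin0r tmulPr).
exact: tmul_monomial.
Qed.

Lemma identity_on_basis n f : in_P n f ->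
  (forall e, peval mul f (basis_subst e) = 0) -> forall s, peval mul f s = 0.
Proof.
move=> fP H.
(* Variables are replaced by basis vectors one at a time: those from [r] to [n - 1] are already
   basis vectors, those below [r] are still arbitrary. *)
suff key r : (r <= n)%N -> forall s, (forall i, (r <= i < n)%N -> exists k, s i = 'X^k) ->
    peval mul f s = 0.
  by move=> s; apply: (key n) => // i /andP[]; rewrite leqNgt => /negP.
elim: r => [|r IH] rn s hs.
  rewrite -(H (fun i => (size (s i)).-1)); apply: (peval_ext _ fP) => i iN.
  by rewrite /basis_subst; have [|k ->] := hs i _; rewrite ?size_polyXn.
rewrite -(_ : peval mul f (upd s r (s r)) = peval mul f s); last first.
  by apply: (peval_ext _ fP) => i _; rewrite /upd; case: eqP => [->|].
apply: (poly_linear_eq0 (g := fun x => peval mul f (upd s r x))).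
  by move=> c x y; apply: (peval_linear tmulPl tmulPr _ _ _ _ fP).
move=> k; apply: IH; first exact: ltnW.
move=> i /andP[ri iN]; rewrite /upd; case: eqP => [_|/eqP ne]; first by exists k.
by apply: hs; rewrite iN ltn_neqAle eq_sym ne ri.
Qed.

(* For basis substitutions the output of all multilinear monomials lies on one
   line, so the identities of degree n are cut out by the functionals recording
   which monomials do not vanish. *)
Definition nonzero_functional (e : nat -> nat) (f : seq (F * term)) : F :=
  \sum_(c <- f) c.1 * (isSome (tabeval tab e c.2))%:R.

Definition determined_output (n : nat) : Prop :=
  forall e, exists k, forall t, multilinear n t -> tabeval tab e t \in [:: None; Some k].

Lemma peval_basis n f e : determined_output n -> in_P n f ->
  exists k, peval mul f (basis_subst e) = nonzero_functional e f *: 'X^k.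
Proof.
move=> /(_ e)[k hk] /allP fP; exists k; rewrite /nonzero_functional scaler_suml.
apply: eq_big_seq => c /fP /hk; rewrite teval_basis !inE => /orP[] /eqP -> /=.
  by rewrite mulr0 scale0r scaler0.
by rewrite mulr1.
Qed.

(** The values of the [(size es).+1] polynomials under the functionals of [es] form a matrix with
    more rows than columns. A nonzero vector in its left kernel gives a combination killed by every
    basis substitution, hence an identity. *)
Lemma codim_upper n (es : seq (nat -> nat)) : determined_output n ->
  (forall e, (forall t, multilinear n t -> tabeval tab e t = None) \/
     exists2 i, (i < size es)%N & forall t, multilinear n t ->
       isSome (tabeval tab e t) = isSome (tabeval tab (nth idfun es i) t)) ->
  ~ has_indep mul n (size es).+1.
Proof.
move=> out cov [f [fP fi]].
pose A : 'M[F]_((size es).+1, size es) :=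
  \matrix_(j, i) nonzero_functional (nth idfun es i) (f j).
have /rowV0Pn[v /sub_kermxP vA vn0] : kermx A != 0.
  rewrite kermx_eq0 /row_free neq_ltn; apply/orP; left.
  exact: leq_ltn_trans (rank_leq_col A) _.
have [h hP hE] := in_P_comb (v 0) fP.
case/eqP: vn0; apply/rowP => j; rewrite mxE; apply: (fi (v 0)) => s.
rewrite -[LHS](hE _ (teval mul s)); apply: (identity_on_basis hP) => e {s}.
have [k ->] := peval_basis e out hP.
suff -> : nonzero_functional e h = 0 by rewrite scale0r.
have [H|[i ies H]] := cov e.
  rewrite /nonzero_functional; apply: big1_seq => c /andP[_ /(allP hP)] /H ->.
  by rewrite mulr0.
have -> : nonzero_functional e h = nonzero_functional (nth idfun es i) h.
  by apply: eq_big_seq => c /(allP hP) /H ->.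
have -> : nonzero_functional (nth idfun es i) h =
    \sum_(j < (size es).+1) v 0 j * nonzero_functional (nth idfun es i) (f j).
  exact: (hE F^o (fun t => (isSome (tabeval tab (nth idfun es i) t))%:R)).
have /rowP/(_ (Ordinal ies)) := vA; rewrite !mxE => /(etrans _); apply.
by apply: eq_bigr => l _; rewrite mxE.
Qed.

End TableAlgebra.

(** * Upper bounds: the functionals on [A^#] *)

(* Three gradings compatible with the table of [A^#]: the number of [z]'s, the
   degree ([1 : 0], [a, b : 1], [z_p : p + 1]) and, below, [bdeg], which counts
   the [b]'s; jointly they separate the basis. *)
Definition zdeg (i : nat) : nat := (2 < i).
Definition ldeg (i : nat) : nat := if i is j.+1 then (j.-1).+1 else 0.
Definition support_size (e : nat -> nat) (l : seq nat) : nat := count (fun i => e i != 0) l.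

Section Tables.
Variables (m : nat) (w : nat -> bool).
Notation u := (blockend m w).
Notation B := (bcount m w).
Notation tabA := (tableA m w).
Notation tabU := (tableAs m w).

Definition bdeg (i : nat) : nat := match i with 0 | 1 => 0 | 2 => 1 | p.+3 => B p end.

Lemma tableAs_z p j : tabU p.+3 j.+1 = if j == u p then Some p.+4 else None.
Proof.
rewrite /tableAs /tableA /= !subSS subn0.
by case: (u p); case: j => [|[|j]].
Qed.

Lemma tableAs_unitr i : tabU i 0 = Some i.
Proof. by case: i. Qed.

Lemma tableAs_letter i j : 0 < i < 3 -> tabU i j.+1 = None.
Proof. by case: i => [|[|[|i]]]. Qed.

Lemma tableAs_cases i j k : tabU i j = Some k ->
  [\/ i = 0 /\ k = j, j = 0 /\ k = i |
      exists p, [/\ i = p.+3, j = (u p).+1 & k = p.+4]].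
Proof.
case: i => [[<-]|i]; first by constructor 1.
case: j => [[<-]|j]; first by constructor 2.
case: i => [|[|p]] //; rewrite tableAs_z; case: eqP => // -> [<-].
by constructor 3; exists p.
Qed.

Lemma zdegD i j k : tabU i j = Some k -> zdeg k = zdeg i + zdeg j.
Proof.
move=> /tableAs_cases[[-> ->]|[-> ->]|[p [-> -> ->]]] //=; rewrite ?addn0 //.
by case: (u p).
Qed.

Lemma ldegD i j k : tabU i j = Some k -> ldeg k = ldeg i + ldeg j.
Proof.
move=> /tableAs_cases[[-> ->]|[-> ->]|[p [-> -> ->]]] //=; rewrite ?addn0 //.
by case: (u p); rewrite addn1.
Qed.

Lemma bdegD i j k : tabU i j = Some k -> bdeg k = bdeg i + bdeg j.
Proof.
move=> /tableAs_cases[[-> ->]|[-> ->]|[p [-> -> ->]]] //=; rewrite ?addn0 //.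
by rewrite bcountS; case: (u p).
Qed.

Lemma degrees_inj i j : zdeg i = zdeg j -> ldeg i = ldeg j -> bdeg i = bdeg j -> i = j.
Proof. by case: i j => [|[|[|i]]] [|[|[|j]]] //= _; lia. Qed.

Lemma ldeg_gt0 i : (i != 0) <= ldeg i.
Proof. by case: i. Qed.

Lemma support_le_ldeg e l : support_size e l <= \sum_(i <- l) ldeg (e i).
Proof.
rewrite /support_size -sum1_count big_mkcond; apply: leq_sum => i _.
by have := ldeg_gt0 (e i); case: (e i != 0).
Qed.

Lemma support_eq0 e l : support_size e l = 0 -> \sum_(i <- l) ldeg (e i) = 0.
Proof.
move=> h; rewrite big1_seq // => i /andP[_ il]; apply/eqP.
have [->//|ei] := eqVneq (e i) 0; move/eqP: h; rewrite -leqn0 leqNgt -has_count.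
by case/negP; apply/hasP; exists i.
Qed.

(** With at most one non-unit variable the product is that variable or the unit, never zero. All
    such substitutions therefore define the same functional. *)
Lemma support_small e t : support_size e (leaves t) <= 1 -> isSome (tabeval tabU e t).
Proof.
elim: t => [i|a IHa b IHb] //=; rewrite /support_size count_cat => h.
have ha : support_size e (leaves a) <= 1 by apply: leq_trans h; apply: leq_addr.
have hb : support_size e (leaves b) <= 1 by apply: leq_trans h; apply: leq_addl.
have unit_of c x : support_size e (leaves c) = 0 -> tabeval tabU e c = Some x -> x = 0.
  move=> /support_eq0 s0 /(tabeval_additive ldegD); rewrite s0.
  by case: x.
case Ea: (tabeval tabU e a) (IHa ha) => [x|//] _; case Eb: (tabeval tabU e b) (IHb hb) => [y|//] _ /=.
have [a0|a1] := posnP (support_size e (leaves a)); first by rewrite (unit_of _ _ a0 Ea).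
have b0 : support_size e (leaves b) = 0 by move: h a1; rewrite /support_size; lia.
by rewrite (unit_of _ _ b0 Eb) tableAs_unitr.
Qed.

Lemma tabeval_shift e t : tabeval tabU (fun i => (e i).+1) t = omap S (tabeval tabA e t).
Proof.
elim: t => [i|a IHa b IHb] //=; rewrite IHa IHb.
by case: (tabeval tabA e a) => [x|] //=; case: (tabeval tabA e b).
Qed.

(** A nonzero product containing [z_p] and s non-unit factors reads s-1 letters of the word from [p]
    on and ends at [z_(p+s-1)], whose index is [p + s + 2]. Starting instead at [p'] with the same
    factor makes the same letters admissible. *)
Lemma tabeval_window e e' i0 p p' L t k :
  (forall i, i != i0 -> e i = e' i) -> e i0 = p.+3 -> e' i0 = p'.+3 ->
  same_factor u L p p' ->
  uniq (leaves t) -> i0 \in leaves t -> support_size e (leaves t) <= L.+1 ->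
  tabeval tabU e t = Some k ->
  k = p + support_size e (leaves t) + 2 /\
  tabeval tabU e' t = Some (p' + support_size e (leaves t) + 2).
Proof.
move=> off e0 e'0 E.
have notin c : i0 \notin leaves c -> tabeval tabU e c = tabeval tabU e' c.
  move=> nc; apply: tabeval_ext => i ic; apply: off.
  by apply: contraNneq nc => <-.
elim: t k => [i|a IHa b IHb] k /=.
  by rewrite inE /support_size /= addn0 => _ /eqP<- _ [<-]; rewrite e0 e'0 /= !addn1 !addn2.
rewrite cat_uniq mem_cat => /and3P[ua dis ub] iab.
rewrite [support_size e (_ ++ _)]count_cat -!/(support_size _ _) => sL.
have sa : support_size e (leaves a) <= L.+1 by apply: leq_trans sL; apply: leq_addr.
have sb : support_size e (leaves b) <= L.+1 by apply: leq_trans sL; apply: leq_addl.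
case Ea: (tabeval tabU e a) => [x|//] /=; case Eb: (tabeval tabU e b) => [y|//] /= xy.
have da := tabeval_additive ldegD Ea; have db := tabeval_additive ldegD Eb.
have la := support_le_ldeg e (leaves a); have lb := support_le_ldeg e (leaves b).
have [ia|nia] := boolP (i0 \in leaves a).
  have ib : i0 \notin leaves b by apply: contra dis => ib; apply/hasP; exists i0.
  have [ex ->] := IHa x ua ia sa Ea; rewrite -(notin b ib) Eb /=.
  case/tableAs_cases: xy => [[x0 _]|[y0 ->]|[q [xq yq ->]]]; first by lia.
    rewrite y0 /= in db *; rewrite tableAs_unitr.
    have -> : support_size e (leaves b) = 0 by lia.
    by rewrite addn0.
  have sb1 : support_size e (leaves b) = 1.
    rewrite yq in db.
    have d1 : \sum_(i <- leaves b) ldeg (e i) = 1 by rewrite -db; case: (u q).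
    have [/support_eq0 s0|] := posnP (support_size e (leaves b)); first by rewrite s0 in d1.
    by lia.
  have sa1 : 0 < support_size e (leaves a).
    by rewrite /support_size -has_count; apply/hasP; exists i0; rewrite ?e0.
  have eq1 : q = p + (support_size e (leaves a)).-1 by lia.
  rewrite (_ : p' + support_size e (leaves a) + 2 =
     (p' + (support_size e (leaves a)).-1).+3); last by lia.
  rewrite yq tableAs_z eq1 E; last by lia.
  rewrite eqxx sb1; split; first by lia.
  by congr Some; lia.
(* A [z] in the right factor survives only when the left factor is the unit. *)
rewrite (negbTE nia) in iab; rewrite -(notin a nia) Ea /=.
have [ey ->] := IHb y ub iab sb Eb.
case/tableAs_cases: xy => [[x0 ->]|[y0 _]|[q [_ yq _]]]; last 2 first.
- by lia.
- have : 0 < support_size e (leaves b).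
    by rewrite /support_size -has_count; apply/hasP; exists i0; rewrite ?e0.
  by move: yq; case: (u q); lia.
rewrite x0 /= in da *.
by have -> : support_size e (leaves a) = 0 by lia.
Qed.

Lemma multilinear_sum n t (g : nat -> nat) : multilinear n t ->
  \sum_(i <- leaves t) g i = \sum_(i < n) g i.
Proof. by move=> E; rewrite (perm_big _ E) -(big_mkord predT g) /index_iota subn0. Qed.

Lemma multilinear_support n t e : multilinear n t ->
  support_size e (leaves t) = support_size e (iota 0 n).
Proof. by move=> E; rewrite /support_size; apply/permP. Qed.

(** The three degrees of a nonzero output are sums over all the variables, hence the same for every
    multilinear monomial, and together they determine the basis element. *)
Lemma determined_output_As n : determined_output tabU n.
Proof.
move=> e.
have [[t0 [m0 [k0 H0]]]|H] := classic (exists t, multilinear n t /\ exists k, tabeval tabU e t = Some k).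
  exists k0 => t mt; case Et: (tabeval tabU e t) => [k|]; rewrite !inE //=.
  have same g : (forall i j l, tabU i j = Some l -> g l = g i + g j) -> g k = g k0.
    move=> gD; rewrite (tabeval_additive gD Et) (tabeval_additive gD H0).
    by rewrite (multilinear_sum (g \o e) mt) (multilinear_sum (g \o e) m0).
  by rewrite (degrees_inj (same _ zdegD) (same _ ldegD) (same _ bdegD)) eqxx.
exists 0 => t mt; case Et: (tabeval tabU e t) => [k|] //.
by case: H; exists t; split=> //; exists k.
Qed.

Lemma determined_output_A n : determined_output tabA n.
Proof.
move=> e; have [k hk] := determined_output_As n (fun i => (e i).+1).
exists k.-1 => t /hk; rewrite tabeval_shift !inE.
by case: (tabeval tabA e t) => [x|] //= /eqP[<-].
Qed.

(** * Representative substitutions *)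

Definition memn n (T : {set 'I_n}) (i : nat) : bool := oapp (mem T) false (insub i).

Lemma memn_ord n (T : {set 'I_n}) (i : 'I_n) : memn T i = (i \in T).
Proof. by rewrite /memn valK. Qed.

(* Substitutes the unit for the variables in [T], [z_p] for [i0], [b] for the
   variables in [Sb] and [a] for all others. *)
Definition rep n (T : {set 'I_n}) (i0 : 'I_n) (Sb : {set 'I_n}) (p : nat) (i : nat) : nat :=
  if i == i0 then p.+3 else if memn T i then 0 else if memn Sb i then 2 else 1.

Lemma rep_set0_gt0 n (i0 : 'I_n) Sb p i : 0 < rep (set0 : {set 'I_n}) i0 Sb p i.
Proof.
rewrite /rep; case: eqP => // _.
have -> : memn (set0 : {set 'I_n}) i = false.
  by rewrite /memn; case: insub => //= j; rewrite inE.
by case: (memn _ _).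
Qed.

(* The number of [b]'s in the factor of length [k - 1] at [p]: a product of [k]
   non-unit elements starting with [z_p] reads that factor. *)
Definition blocks_in p k := B (p + k.-1) - B p.

Definition rep_keys n (TT : seq {set 'I_n}) (P : seq nat) :
    seq ({set 'I_n} * ('I_n * nat) * {set 'I_n}) :=
  [seq (x, Sb) | x <- [seq (T, y) | T <- TT, y <- [seq (i, p) | i <- enum 'I_n, p <- P]],
     Sb <- enum [set Sb : {set 'I_n} | (Sb \subset ~: x.1) &
                  (#|Sb| == blocks_in x.2.2 (n - #|x.1|))]].

(** The extra entry [e0] stands for the class of substitutions whose output is the unit or a letter;
    all others output some [z] and are represented by the keys. *)
Definition reps n (e0 : nat -> nat) (TT : seq {set 'I_n}) (P : seq nat) : seq (nat -> nat) :=
  e0 :: [seq rep x.1.1 x.1.2.1 x.2 x.1.2.2 | x <- rep_keys TT P].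

Lemma size_reps n e0 (TT : seq {set 'I_n}) P : size (reps e0 TT P) =
  (\sum_(T <- TT) n * \sum_(p <- P) 'C(n - #|T|, blocks_in p (n - #|T|))).+1.
Proof.
rewrite /= size_map size_allpairs_dep sumnE big_map big_allpairs_dep; congr _.+1.
apply: eq_bigr => T _; rewrite big_allpairs_dep big_enum /=.
rewrite (eq_bigr (fun=> \sum_(p <- P) 'C(n - #|T|, blocks_in p (n - #|T|)))).
  by rewrite sum_nat_const card_ord.
move=> i _; apply: eq_bigr => p _.
by rewrite -cardE cards_draws cardsCs setCK card_ord.
Qed.

(** A substitution with a nonzero output involving a [z] has exactly one [z_p]; the rest are units,
    letters [a] and letters [b]. Moving [p] to a representative of its factor does not change which
    monomials survive, and the count of letters [b] forces the size of [Sb]. *)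
Lemma reps_cover n (e0 : nat -> nat) (TT : seq {set 'I_n}) P (e : nat -> nat) :
  covers_factors u n P -> [set i : 'I_n | e i == 0] \in TT ->
  (support_size e (iota 0 n) <= 1 -> support_size e0 (iota 0 n) <= 1) ->
  (forall t, multilinear n t -> tabeval tabU e t = None) \/
  exists2 i, i < size (reps e0 TT P) & forall t, multilinear n t ->
       isSome (tabeval tabU e t) = isSome (tabeval tabU (nth idfun (reps e0 TT P) i) t).
Proof.
move=> cov TTe small.
have [[t0 [m0 [k0 H0]]]|H] := classic (exists t, multilinear n t /\ exists k, tabeval tabU e t = Some k);
    last first.
  left=> t mt; case Et: (tabeval tabU e t) => [k|] //.
  by case: H; exists t; split=> //; exists k.
right.
have sumE g : (forall i j l, tabU i j = Some l -> g l = g i + g j) ->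
    g k0 = \sum_(i < n) g (e i).
  by move=> gD; rewrite (tabeval_additive gD H0) (multilinear_sum (g \o e) m0).
have zE := sumE _ zdegD; have lE := sumE _ ldegD; have bE := sumE _ bdegD.
(* If the output is not a [z], it has [ldeg] at most 1, so at most one variable is not the unit and
   [e0] gives the same functional. *)
have [z0|zn0] := posnP (zdeg k0).
  have s1 : support_size e (iota 0 n) <= 1.
    rewrite -(multilinear_support e m0); apply: leq_trans (support_le_ldeg _ _) _.
    rewrite (multilinear_sum (ldeg \o e) m0) -lE.
    by case: k0 z0 {H0 zE lE bE sumE} => [|[|[|]]].
  exists 0 => //= t mt.
  by rewrite !support_small // (multilinear_support _ mt) ?small.
have [i0 /andP[_ ei0]] : exists i0 : 'I_n, true && (2 < e i0).
  apply/existsP; apply: contraLR zn0; rewrite negb_exists => /forallP h.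
  by rewrite zE big1 // => i _; have := h i; rewrite /zdeg /=; case: (2 < e i).
have other (i : 'I_n) : i != i0 -> e i < 3.
  move=> ne; rewrite ltnNge; apply/negP => ei; move: zE.
  rewrite (bigD1 i0) //= (bigD1 i) //= /zdeg ei0 ei; case: (2 < k0); lia.
have [p ep] : exists p, e i0 = p.+3 by exists (e i0 - 3); lia.
have [p' p'P Epp] := cov p.
pose T := [set i : 'I_n | e i == 0]; pose Sb := [set i : 'I_n | e i == 2].
have sN : support_size e (iota 0 n) = n - #|T|.
  have -> : n - #|T| = #|~: T| by rewrite [RHS]cardsCs setCK card_ord.
  rewrite /support_size -val_enum_ord count_map -sum1_count big_enum_cond /= -sum1_card.
  by apply: eq_bigl => i; rewrite !inE.
have sN0 : 0 < support_size e (iota 0 n).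
  by rewrite /support_size -has_count; apply/hasP; exists (val i0); rewrite ?mem_iota ?ep /=.
have i0T : i0 \notin T by rewrite inE ep.
have off i : (i < n)%N -> i != i0 -> e i = rep T i0 Sb p' i.
  move=> iN ne; rewrite /rep (negbTE ne) -[i]/(val (Ordinal iN)) !memn_ord !inE /=.
  by have := other (Ordinal iN) ne; case: (e i) => [|[|[|]]].
have rep0 : rep T i0 Sb p' i0 = p'.+3 by rewrite /rep eqxx.
have win (t : term) (e1 e2 : nat -> nat) p1 p2 k :
    multilinear n t -> e1 i0 = p1.+3 -> e2 i0 = p2.+3 ->
    (forall i, i < n -> i != i0 -> e1 i = e2 i) -> same_factor u n p1 p2 ->
    support_size e1 (leaves t) <= n.+1 ->
    tabeval tabU e1 t = Some k -> k = p1 + support_size e1 (leaves t) + 2 /\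
    tabeval tabU e2 t = Some (p2 + support_size e1 (leaves t) + 2).
  move=> mt h1 h2 h12 E sl H.
  (* [tabeval_window] asks for agreement at every index other than [i0], so [e2] is patched by [e1]
     outside the [n] variables. *)
  pose e3 i := if i < n then e2 i else e1 i.
  have h3 : e3 i0 = p2.+3 by rewrite /e3 ltn_ord.
  have h13 (i : nat) : i != i0 -> e1 i = e3 i by rewrite /e3; case: ltnP => // iN; apply: h12.
  have i0t : val i0 \in leaves t by rewrite (multilinear_mem _ mt) ltn_ord.
  have [-> <-] := tabeval_window h13 h1 h3 E (multilinear_uniq mt) i0t sl H.
  split=> //; apply: tabeval_ext => i; rewrite (multilinear_mem _ mt) /e3.
  by move=> ->.
have sle (f : nat -> nat) t : multilinear n t -> support_size f (leaves t) <= n.+1.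
  move=> mt; rewrite (multilinear_support _ mt); apply: leq_trans (count_size _ _) _.
  by rewrite size_iota leqnSn.
have nz t : multilinear n t ->
    isSome (tabeval tabU e t) = isSome (tabeval tabU (rep T i0 Sb p') t).
  move=> mt; case E1: (tabeval tabU e t) => [k|].
    by have [_ ->] := win t e _ p p' k mt ep rep0 off Epp (sle _ _ mt) E1.
  case E2: (tabeval tabU (rep T i0 Sb p') t) => [k|] //.
  have off' i : i < n -> i != i0 -> rep T i0 Sb p' i = e i by move=> iN ne; rewrite off.
  by have [_] := win t _ e p' p k mt rep0 ep off' (same_factor_sym Epp) (sle _ _ mt) E2; rewrite E1.
have [k0E _] := win t0 e _ p p' k0 m0 ep rep0 off Epp (sle _ _ m0) H0.
rewrite (multilinear_support _ m0) sN in k0E.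
rewrite sN in sN0.
(* Comparing [bdeg] of the output with the sum over the variables: the [z] contributes the block
   ends before [p] and each variable in [Sb] contributes 1. *)
have bS : bcount m w (p + (n - #|T|).-1) = bcount m w p + #|Sb|.
  have -> : #|Sb| = \sum_(i < n | i != i0) bdeg (e i).
    rewrite -sum1_card big_mkcond [RHS]big_mkcond; apply: eq_bigr => i _; rewrite inE.
    have [->|ne] := eqVneq i i0; first by rewrite ep.
    by have := other i ne; case: (e i) => [|[|[|]]].
  have -> : bcount m w p = bdeg (e i0) by rewrite ep.
  have := bE; rewrite (bigD1 i0) //= => <-.
  by rewrite k0E (_ : _ + 2 = (p + (n - #|T|).-1).+3) //; lia.
have key : (T, (i0, p'), Sb) \in rep_keys TT P.
  apply/allpairsPdep; exists (T, (i0, p')), Sb; split=> //=.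
    apply/allpairsP; exists (T, (i0, p')); split=> //=.
    by apply/allpairsP; exists (i0, p'); rewrite mem_enum.
  rewrite mem_enum inE; apply/andP; split.
    by apply/subsetP => i; rewrite !inE => /eqP->.
  rewrite /blocks_in -(same_factor_bcount Epp) ?bS ?addKn //.
  by apply: leq_trans (leq_subr #|T| n); apply: leq_pred.
exists (index (T, (i0, p'), Sb) (rep_keys TT P)).+1.
  by rewrite /= ltnS size_map index_mem.
by move=> t mt; rewrite /= (nth_map (T, (i0, p'), Sb)) ?index_mem // nth_index //= nz.
Qed.
End Tables.

(** * Lower bounds: nested commutators *)

(* Fills the [true] slots of [pat] from [sb] and the [false] slots from [sa]. *)
Fixpoint arrange (T : Type) (pat : seq bool) (sa sb : seq T) : seq T :=
  match pat, sa, sb with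
  | true :: pat', _, y :: sb' => y :: arrange pat' sa sb'
  | false :: pat', y :: sa', _ => y :: arrange pat' sa' sb
  | _, _, _ => [::]
  end.

Lemma arrange_spec (T : eqType) pat (sa sb : seq T) :
  count idfun pat = size sb -> count negb pat = size sa ->
  perm_eq (arrange pat sa sb) (sa ++ sb) /\
  forall P : pred T, all P sb -> all (predC P) sa -> map P (arrange pat sa sb) = pat.
Proof.
elim: pat sa sb => [|[] pat IH] sa sb /=.
- by case: sa sb => [|? ?] [].
- case: sb => [//|y sb] [hb] ha; have [pe mp] := IH sa sb hb ha.
  split=> [|P /= /andP[Py Psb] Psa]; last by rewrite /= Py mp.
  by rewrite /= perm_sym -cat1s perm_catCA perm_cons perm_sym.
case: sa => [//|y sa] hb [ha]; have [pe mp] := IH sa sb hb ha.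
split=> [|P Psb /= /andP[Py Psa]]; first by rewrite /= perm_cons.
by rewrite /= (negbTE Py) mp.
Qed.

Section LowerBound.
Local Open Scope ring_scope.
Variables (F : fieldType) (m : nat) (w : nat -> bool).
Notation u := (blockend m w).
Notation B := (bcount m w).
Notation tabA := (tableA m w).
Notation tabU := (tableAs m w).
Notation mulU := (@tmul F tabU).
Notation mulA := (@tmul F tabA).
Let mPl := @tmulPl F tabU.
Let mPr := @tmulPr F tabU.

Lemma tmul_unitl x : mulU 1 x = x.
Proof.
apply/eqP; rewrite -subr_eq0; apply/eqP.
apply: (poly_linear_eq0 (g := fun x => mulU 1 x - x)) => [c y z|k].
  by rewrite mPr scalerBr opprD addrACA.
by rewrite -(expr0 'X) tmul_monomial subrr.
Qed.

Lemma tmul_unitr x : mulU x 1 = x.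
Proof.
apply/eqP; rewrite -subr_eq0; apply/eqP.
apply: (poly_linear_eq0 (g := fun x => mulU x 1 - x)) => [c y z|k].
  by rewrite mPl scalerBr opprD addrACA.
by rewrite -(expr0 'X) tmul_monomial tableAs_unitr subrr.
Qed.

(** A letter times anything but the unit is zero, so each commutator of a [z] with a letter is just
    the right product, which is nonzero only for the letter prescribed by the word. *)
Lemma foldl_pcomm_letters (e : nat -> nat) f ys q :
  {in ys, forall y, (0 < e y < 3)%N} ->
  peval mulU f (basis_subst F e) = 'X^(q.+3) ->
  peval mulU (foldl (@pcomm F) f ys) (basis_subst F e) =
    if map e ys == [seq (u (q + r)).+1 | r <- iota 0 (size ys)]
    then 'X^((q + size ys).+3) else 0.
Proof.
elim: ys f q => [|y ys IH] f q he ef; first by rewrite /= ef addn0.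
rewrite [LHS]/=.
have ey := he y (mem_head _ _).
have hys : {in ys, forall y, (0 < e y < 3)%N} by move=> z zy; apply: he; rewrite inE zy orbT.
have e1 : peval mulU (pcomm f y) (basis_subst F e) =
    bvec F (if e y == (u q).+1 then Some q.+4 else None).
  rewrite (peval_pcomm mPl mPr) ef /basis_subst !tmul_monomial.
  rewrite (tableAs_letter m w _ ey) subr0.
  by case: (e y) ey => [|j] // _; rewrite tableAs_z eqSS.
rewrite /= eqseq_cons addn0; case: eqP e1 => [_|_] /= e1; last first.
  exact: (foldl_pcomm_eq0 mPl mPr).
rewrite (IH _ q.+1 hys) // addSnnS (iotaDl 1 0) -map_comp.
congr (if _ == _ then _ else _); apply: eq_map => r /=; by rewrite addSnnS.
Qed.

Variable n' : nat.
Notation n := n'.+1.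

Definition first_out (T : {set 'I_n}) : 'I_n := odflt ord0 [pick i in ~: T].

(** The variables outside [T] other than the first, ordered so that those of [Sb] sit exactly under
    the letters [b] of the prefix of length k-1. *)
Definition comm_word (k : nat) (T Sb : {set 'I_n}) : seq 'I_n :=
  arrange (mkseq u k.-1) (enum ((~: T :\ first_out T) :\: Sb)) (enum Sb).

Definition comm_poly (k : nat) (x : {set 'I_n} * {set 'I_n}) : seq (F * term) :=
  nested_comm F (first_out x.1) (map val (comm_word k x.1 x.2)) (map val (enum x.1)).

Definition comm_subst (x : {set 'I_n} * {set 'I_n}) : nat -> nat :=
  rep x.1 (first_out x.1) x.2 0.

Definition comm_keys (k : nat) : seq ({set 'I_n} * {set 'I_n}) :=
  [seq (T, Sb) | T <- enum [set T : {set 'I_n} | #|T| == (n - k)%N],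
     Sb <- enum [set Sb : {set 'I_n} | (Sb \subset ~: T :\ first_out T) & (#|Sb| == B k.-1)%N]].

Section Keys.
Variables (k : nat) (T : {set 'I_n}).
Hypotheses (k0 : (0 < k <= n)%N) (cT : #|T| = (n - k)%N).

Lemma card_out : #|~: T| = k.
Proof. by rewrite cardsCs setCK card_ord cT; lia. Qed.

Lemma first_out_notin : first_out T \notin T.
Proof.
rewrite /first_out; case: pickP => [i|none]; first by rewrite inE.
by have := card_out; rewrite (eq_card0 none); lia.
Qed.

Lemma card_letters : #|~: T :\ first_out T| = k.-1.
Proof.
have := cardsD1 (first_out T) (~: T).
by rewrite card_out in_setC first_out_notin => ->.
Qed.

Lemma bcount_count q : count idfun (mkseq u q) = B q.
Proof.
rewrite /mkseq count_map -sum1_count big_mkcond /bcount -(big_mkord predT (fun r => (u r : nat))).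
by rewrite /index_iota subn0; apply: eq_bigr => r _ /=; case: (u r).
Qed.

Variable Sb : {set 'I_n}.
Hypotheses (sS : Sb \subset ~: T :\ first_out T) (cS : #|Sb| = B k.-1).

Lemma comm_word_spec :
  perm_eq (comm_word k T Sb) (enum (~: T :\ first_out T)) /\
  forall P : pred 'I_n, {in ~: T :\ first_out T, forall i, P i = (i \in Sb)} ->
    map P (comm_word k T Sb) = mkseq u k.-1.
Proof.
have cSa : #|(~: T :\ first_out T) :\: Sb| = (k.-1 - B k.-1)%N.
  by rewrite cardsD (setIidPr sS) cS card_letters.
have h1 : count idfun (mkseq u k.-1) = size (enum Sb) by rewrite bcount_count -cardE cS.
have h2 : count negb (mkseq u k.-1) = size (enum ((~: T :\ first_out T) :\: Sb)).
  rewrite -cardE cSa -bcount_count.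
  rewrite (eq_count (a2 := predC idfun)) //.
  by have := count_predC idfun (mkseq u k.-1); rewrite size_mkseq; lia.
have [pe mp] := arrange_spec h1 h2; split.
  apply: perm_trans pe _; apply: uniq_perm; rewrite ?enum_uniq //.
    rewrite cat_uniq !enum_uniq andbT /=; apply/hasPn => i.
    by rewrite !mem_enum => iS; rewrite inE iS.
  move=> i; rewrite mem_cat !mem_enum [i \in _ :\: _]inE.
  by have [iS|//] := boolP (i \in Sb); rewrite ?orbF //= (subsetP sS).
move=> P HP; apply: mp; apply/allP => i; rewrite mem_enum.
  by move=> iS; rewrite HP // (subsetP sS).
by rewrite inE => /andP[iS iT] /=; rewrite HP.
Qed.

Lemma comm_word_size : size (comm_word k T Sb) = k.-1.
Proof. by have [/perm_size-> _] := comm_word_spec; rewrite -cardE card_letters. Qed.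

Lemma comm_word_perm : perm_eq (first_out T :: comm_word k T Sb ++ enum T) (enum 'I_n).
Proof.
have [pe _] := comm_word_spec.
have fo := first_out_notin.
apply: (@perm_trans _ (first_out T :: enum (~: T :\ first_out T) ++ enum T)).
  by rewrite perm_cons perm_cat2r.
apply: uniq_perm; rewrite ?enum_uniq //.
  rewrite /= mem_cat !mem_enum !inE eqxx (negbTE fo) cat_uniq !enum_uniq andbT /=.
  by apply/hasPn => i; rewrite !mem_enum !inE => ->; rewrite andbF.
move=> i; rewrite inE mem_cat !mem_enum !inE.
by case: eqP => //= _; case: (i \in T).
Qed.

Lemma in_P_comm_poly : in_P n (comm_poly k (T, Sb)).
Proof.
apply: in_P_nested; rewrite -map_cat -map_cons -val_enum_ord; apply: perm_map.
exact: comm_word_perm.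
Qed.

End Keys.

Lemma comm_keysP k x : x \in comm_keys k ->
  [/\ #|x.1| = (n - k)%N, x.2 \subset ~: x.1 :\ first_out x.1 & #|x.2| = B k.-1].
Proof.
case/allpairsPdep => T [Sb [h1 h2 ->]] /=.
by move: h1 h2; rewrite !mem_enum !inE => /eqP-> /andP[-> /eqP->].
Qed.

Lemma comm_keys_uniq k : uniq (comm_keys k).
Proof.
apply: allpairs_uniq_dep => [|T _|]; rewrite ?enum_uniq //.
by move=> [a b] [c d] _ _ [-> ->].
Qed.

Lemma comm_keys_size k : (0 < k <= n)%N ->
  size (comm_keys k) = ('C(n, k) * 'C(k.-1, B k.-1))%N.
Proof.
move=> hk; rewrite size_allpairs_dep sumnE big_map.
rewrite (eq_big_seq (fun=> 'C(k.-1, B k.-1))); last first.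
  move=> T; rewrite mem_enum inE => /eqP cT.
  by rewrite -cardE cards_draws (card_letters hk cT).
rewrite big_const_seq count_predT iter_addn_0 mulnC -cardE.
by rewrite card_draws card_ord bin_sub //; case/andP: hk.
Qed.

(** If the unit sets differ, having equal size, some variable inside the commutators receives the
    unit and the value is zero. If they agree, the outer variables disappear and the commutators
    survive exactly when the letters substituted spell the prefix, that is when the sets of
    [b]-variables agree. *)
Lemma comm_poly_dual k x y : (1 < k <= n)%N -> x \in comm_keys k -> y \in comm_keys k ->
  (peval mulU (comm_poly k x) (basis_subst F (comm_subst y)) == 0) = (x != y).
Proof.
move=> hk; have hk0 : (0 < k <= n)%N by lia.
case: x y => [T Sb] [T' Sb'] /comm_keysP[/= cT sS cS] /comm_keysP[/= cT' sS' cS'].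
rewrite xpair_eqE; set e := comm_subst (T', Sb').
have eT (i : 'I_n) : i \in T' -> basis_subst F e i = 1.
  move=> iT; rewrite /basis_subst /e /comm_subst /rep /= memn_ord iT.
  have [ei|_] := eqVneq; last by rewrite expr0.
  by have := first_out_notin hk0 cT'; rewrite -(val_inj ei) iT.
have [TT|nTT] := eqVneq T T'; last first.
  have [i iT' iT] : exists2 i, i \in T' & i \notin T.
    apply/subsetPn; apply: contraNN nTT => sub.
    by rewrite eq_sym eqEcard sub cT cT' leqnn.
  apply/eqP; apply: (nested_comm_unit mPl mPr (one := 1)) tmul_unitl tmul_unitr _ _.
    by rewrite -size_eq0 size_map (comm_word_size hk0 cT sS cS); lia.
  exists (val i); last exact: eT.
  rewrite -map_cons; apply: map_f.
  have := perm_mem (comm_word_perm hk0 cT sS cS) i.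
  by rewrite -cat_cons mem_cat mem_enum (negbTE iT) orbF mem_enum => ->.
subst T'; rewrite /comm_poly /nested_comm /=.
rewrite (foldl_pmulr_unit mPl (one := 1) _ tmul_unitr); last first.
  by move=> t /mapP[i]; rewrite mem_enum => iT ->; apply: eT.
have [pe mp] := comm_word_spec hk0 cT sS cS.
have letter (i : 'I_n) : i \in ~: T :\ first_out T -> e i = (i \in Sb').+1.
  rewrite !inE => /andP[ne iT]; rewrite /e /comm_subst /rep /= !memn_ord (negbTE iT).
  by rewrite -[_ == _ :> nat]/(i == first_out T) (negbTE ne); case: (i \in Sb').
have ltr : {in map val (comm_word k T Sb), forall y, (0 < e y < 3)%N}.
  move=> y /mapP[i]; rewrite (perm_mem pe) mem_enum => /letter ei ->.
  by rewrite ei; case: (i \in Sb').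
rewrite (foldl_pcomm_letters (q := 0) ltr); last first.
  by rewrite peval_Var /basis_subst /e /comm_subst /rep eqxx.
rewrite size_map (comm_word_size hk0 cT sS cS).
have -> : (map e (map val (comm_word k T Sb)) == [seq (u (0 + r)).+1 | r <- iota 0 k.-1])
    = (Sb == Sb').
  rewrite -map_comp.
  have -> : [seq (u (0 + r)).+1 | r <- iota 0 k.-1] =
     [seq (i \in Sb).+1 | i <- comm_word k T Sb].
    have := congr1 (map (fun b : bool => b.+1)) (mp (mem Sb) (fun _ _ => erefl)).
    by rewrite -!map_comp => ->.
  apply/eqP/eqP => [/eq_in_map E|E]; last first.
    apply/eq_in_map => i; rewrite (perm_mem pe) mem_enum => /letter /= ->.
    by rewrite E.
  apply/setP => i; have [iT|iT] := boolP (i \in ~: T :\ first_out T).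
    have := E i; rewrite (perm_mem pe) mem_enum => /(_ iT) /=.
    by rewrite letter //; case: (i \in Sb); case: (i \in Sb').
  have out (A : {set 'I_n}) : A \subset ~: T :\ first_out T -> (i \in A) = false.
    by move=> /subsetP sA; apply: contraNF iT => /sA.
  by rewrite !out.
have [_|_] := eqVneq Sb Sb'; last by rewrite eqxx.
by apply/negbTE; rewrite expf_neq0 // polyX_eq0.
Qed.

Lemma has_indep_As k : (1 < k <= n)%N -> has_indep mulU n ('C(n, k) * 'C(k.-1, B k.-1)).
Proof.
move=> hk; have hk0 : (0 < k <= n)%N by lia.
rewrite -comm_keys_size //.
apply: (has_indep_dual (f := comm_poly k) (g := fun y => basis_subst F (comm_subst y))).
- exact: comm_keys_uniq.
- by move=> [T Sb] /comm_keysP[/= h1 h2 h3]; apply: in_P_comm_poly.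
- by move=> x y xk yk; apply: comm_poly_dual.
Qed.

(** Multiplication by ['X] is the embedding of A into its unitization, since adjoining the unit
    shifts basis indices by one. *)
Lemma peval_shift f e : 'X * peval mulA f (basis_subst F e) =
  peval mulU f (basis_subst F (fun i => (e i).+1)).
Proof.
rewrite /peval mulr_sumr; apply: eq_bigr => c _.
rewrite !teval_basis tabeval_shift -scalerAr; congr (_ *: _).
by case: (tabeval tabA e c.2) => [x|] /=; rewrite ?mulr0 // exprS.
Qed.

(** For k = n no variable receives the unit, so the dual family already lives in A. *)
Lemma has_indep_A : (1 < n)%N -> has_indep mulA n 'C(n.-1, B n.-1).
Proof.
move=> n1; have hk : (1 < n <= n)%N by rewrite n1 leqnn.
have -> : 'C(n.-1, B n.-1) = size (comm_keys n) by rewrite comm_keys_size ?binn ?mul1n //; lia.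
apply: (has_indep_dual (f := comm_poly n)
   (g := fun y => basis_subst F (predn \o comm_subst y))).
- exact: comm_keys_uniq.
- move=> [T Sb] /comm_keysP[/= h1 h2 h3]; apply: in_P_comm_poly => //; lia.
move=> x y xk yk; rewrite -(comm_poly_dual hk xk yk).
have [cy _ _] := comm_keysP yk.
have y0 : y.1 = set0 by apply/eqP; rewrite -cards_eq0 cy subnn.
have pos i : comm_subst y i = (comm_subst y i).-1.+1.
  by rewrite prednK // /comm_subst y0 rep_set0_gt0.
have -> : peval mulU (comm_poly n x) (basis_subst F (comm_subst y)) =
    'X * peval mulA (comm_poly n x) (basis_subst F (predn \o comm_subst y)).
  rewrite peval_shift; apply: (eq_bigr (fun c => _)) => c _; congr (_ *: _).
  by apply: teval_ext => i _; rewrite /basis_subst [in LHS]pos.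
by rewrite mulf_eq0 polyX_eq0.
Qed.

End LowerBound.

(** * Codimensions against the two kinds of bounds *)

Lemma is_codim_ge (F : fieldType) (V : lmodType F) (mul : V -> V -> V) n c L :
  is_codim mul n c -> has_indep mul n L -> L <= c.
Proof.
move=> [_ H] HL; rewrite leqNgt; apply/negP => cL.
have [f [fP fi]] : has_indep mul n c.+1.
  elim: L cL HL => [//|L IH]; rewrite ltnS leq_eqVlt => /orP[/eqP<- //|cL] /has_indep_pred.
  exact: IH.
exact: H f fP fi.
Qed.

Lemma is_codim_le (F : fieldType) (V : lmodType F) (mul : V -> V -> V) n c U :
  is_codim mul n c -> ~ has_indep mul n U.+1 -> c <= U.
Proof.
move=> [[f [fP fi]] _] HU; rewrite leqNgt; apply/negP => cU; apply: HU.
have : has_indep mul n c by exists f.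
elim: c cU {f fP fi} => [//|c IH]; rewrite ltnS leq_eqVlt => /orP[/eqP<- //|cU] /has_indep_pred.
exact: IH.
Qed.

Section UpperBound.
Variables (F : fieldType) (m : nat) (w : nat -> bool).

Lemma codim_upper_As n P : covers_factors (blockend m w) n P ->
  ~ has_indep (@tmul F (tableAs m w)) n
      (size (reps m w (fun=> 0) (enum {set 'I_n}) P)).+1.
Proof.
move=> cov; apply: codim_upper => [|e]; first exact: determined_output_As.
apply: reps_cover => //; first by rewrite mem_enum.
by move=> _; rewrite /support_size count_pred0.
Qed.

Lemma codim_upper_A n P : covers_factors (blockend m w) n P ->
  ~ has_indep (@tmul F (tableA m w)) n
      (size (reps m w (fun=> 1) [:: set0 : {set 'I_n}] P)).+1.
Proof.
move=> cov; set es := reps _ _ _ _ _.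
rewrite -(size_map (fun e => predn \o e) es).
apply: codim_upper => [|e]; first exact: determined_output_A.
have [||H|[i ies H]] := @reps_cover m w n (fun=> 1) [:: set0] P (fun i => (e i).+1) cov.
- by rewrite inE; apply/eqP/setP => i; rewrite !inE.
- by [].
- left=> t /H; rewrite tabeval_shift.
  by case: (tabeval _ e t).
right; exists i; first by rewrite size_map.
move=> t /H; rewrite tabeval_shift (nth_map idfun) //.
(* With [T] empty and [e0] constantly 1, no representative uses the unit, so each one is a shifted
   substitution in A. *)
have pos j : nth idfun es i j = ((predn \o nth idfun es i) j).+1.
  rewrite /= prednK //; case: i ies {H} => [//|i] /=; rewrite ltnS size_map => il.
  have x0 : {set 'I_n} * ('I_n * nat) * {set 'I_n}.
    by case: (rep_keys _ _ _ _) il => [//|x *]; exact: x.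
  rewrite (nth_map x0) //; have := mem_nth x0 il.
  case/allpairsPdep => x [Sb [/allpairsP[[T y] [/= hT _ ->]] _ ->]] /=.
  by move: hT; rewrite inE => /eqP->; apply: rep_set0_gt0.
rewrite (@tabeval_ext (tableAs m w) _ (fun j => ((predn \o nth idfun es i) j).+1)); last first.
  by move=> j _.
rewrite tabeval_shift.
by case: (tabeval _ e t); case: (tabeval _ _ t).
Qed.

End UpperBound.

(** * Binomial coefficients and entropy *)

Section BinomialSums.
Import Num.Theory.
Delimit Scope ring_scope with ring.
Local Open Scope R_scope.

Lemma INR_ge0 n : 0 <= INR n. Proof. exact: pos_INR. Qed.

Lemma leq_INR a b : (a <= b)%N -> INR a <= INR b.
Proof. by move=> /leP/le_INR. Qed.

Lemma INR_addn a b : INR (a + b)%N = INR a + INR b. Proof. exact: plus_INR. Qed.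
Lemma INR_muln a b : INR (a * b)%N = INR a * INR b. Proof. exact: mult_INR. Qed.

Definition bterm (x y : R) (n i : nat) : R := INR 'C(n, i) * (x ^ (n - i)%N * y ^ i).

Lemma binomial_sum x y n : (x + y) ^ n = (\sum_(i < n.+1) bterm x y n i)%ring.
Proof.
rewrite RpowE RplusE exprDn; apply: eq_bigr => i _.
by rewrite /bterm INRE !RpowE !RmultE mulr_natl.
Qed.

Lemma bterm_ge0 x y n i : 0 <= x -> 0 <= y -> 0 <= bterm x y n i.
Proof.
by move=> x0 y0; apply: Rmult_le_pos; [exact: INR_ge0|apply: Rmult_le_pos; apply: pow_le].
Qed.

Lemma bterm_le x y n i : 0 <= x -> 0 <= y -> (i <= n)%N -> bterm x y n i <= (x + y) ^ n.
Proof.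
move=> x0 y0 iN; rewrite binomial_sum; apply/RleP.
rewrite -ltnS in iN; rewrite (bigD1 (Ordinal iN)) //= lerDl.
by apply: sumr_ge0 => j _; apply/RleP/bterm_ge0.
Qed.

(** The largest of the n+1 terms is at least their average. *)
Lemma bterm_max x y n : exists2 k, (k <= n)%N & (x + y) ^ n <= INR n.+1 * bterm x y n k.
Proof.
apply: NNPP => none.
have lt k : (k <= n)%N -> INR n.+1 * bterm x y n k < (x + y) ^ n.
  by move=> kn; apply: Rnot_le_lt => h; apply: none; exists k.
have : INR n.+1 * (x + y) ^ n < INR n.+1 * (x + y) ^ n; last by lra.
rewrite {1}binomial_sum RmultE mulr_sumr [X in _ < X]RmultE INRE mulr_natl -[in X in _ < X](card_ord n.+1) -sumr_const.
apply/RltP/ltr_sum => [|i _].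
  by apply/hasP; exists ord0; rewrite // mem_index_enum.
by rewrite -INRE; apply/RltP/lt; rewrite -ltnS.
Qed.

Lemma INR_sum (I : Type) (s : seq I) (a : I -> nat) :
  INR (\sum_(i <- s) a i)%N = (\sum_(i <- s) INR (a i))%ring.
Proof. by rewrite INRE natr_sum; apply: eq_bigr => i _; rewrite INRE. Qed.

Lemma sum_const_le (I : eqType) (s : seq I) (a : I -> nat) c :
  (forall i, i \in s -> INR (a i) <= c) -> INR (\sum_(i <- s) a i)%N <= INR (size s) * c.
Proof.
elim: s => [|i s IH] H; first by rewrite big_nil /=; lra.
have Hi := H i (mem_head _ _).
have {IH} := IH (fun j js => H j (mem_behead (s := i :: s) js)).
rewrite big_cons INR_addn -[size (i :: s)]/(size s).+1 S_INR; lra.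
Qed.

(** Expanding [(1 + x) ^ n] as a product over the variables gives one term per set [T], with a
    factor 1 inside [T] and [x] outside. *)
Lemma sum_sets_le n (a : {set 'I_n} -> nat) M x :
  (forall T, INR (a T) <= M * x ^ (n - #|T|)%N) ->
  INR (\sum_(T <- enum {set 'I_n}) a T)%N <= M * (1 + x) ^ n.
Proof.
move=> H.
have -> : M * (1 + x) ^ n = (\sum_(T : {set 'I_n}) M * x ^+ (n - #|T|))%ring.
  rewrite -[n in LHS]card_ord RmultE RpowE RplusE -prodr_const.
  rewrite (bigA_distr _ _ (fun=> 1%ring) (fun=> x)) mulr_sumr.
  apply: eq_big => [T|T _]; first by rewrite inE.
  congr (_ * _)%ring.
  rewrite (bigID (mem T)) /= big1 => [|i ->] //; rewrite mul1r.
  rewrite (eq_bigr (fun=> x)) => [|i /negbTE -> //].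
  rewrite prodr_const; congr (_ ^+ _)%ring.
  have -> : (n - #|T|)%N = #|~: T| by rewrite [RHS]cardsCs setCK card_ord.
  by apply: eq_card => i; rewrite !inE.
rewrite INR_sum big_enum /=; apply/RleP/ler_sum => T _.
by apply/RleP; rewrite -RmultE -RpowE.
Qed.
End BinomialSums.

(** * The mode of a binomial distribution, over the integers *)

Section NatBinomial.
Local Open Scope nat_scope.

(* Up to the factor [n ^ n], the distribution of a binomial variable of mean [j]; its mode is [j]. *)
Let t n j i := 'C(n, i) * (expn (n - j) (n - i) * expn j i).

Lemma mode_step n j i : j <= n -> i < n ->
  ((n - i) * j * t n j i = i.+1 * (n - j) * t n j i.+1)%N.
Proof.
move=> jn iN; rewrite /t (_ : n - i = (n - i.+1).+1)%N; last by lia.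
rewrite !expnS; have := mul_bin_left n i; rewrite (_ : n - i = (n - i.+1).+1)%N; last by lia.
move=> E; rewrite -[RHS](_ : (i.+1 * 'C(n, i.+1)) * ((n - j) * (expn (n - j) (n - i.+1) * (j * expn j i))) = _); last by lia.
rewrite E; lia.
Qed.

(** By [mode_step] the terms increase up to [j] and decrease afterwards. The cases j = n and j = 0,
    where the ratio cannot be cancelled, are settled by a vanishing power. *)
Lemma mode_max n j i : j <= n -> i <= n -> t n j i <= t n j j.
Proof.
move=> jn iN.
have up d i0 : i0 + d = j -> t n j i0 <= t n j j.
  elim: d i0 => [|d IH] i0 e; first by rewrite -e addn0.
  apply: leq_trans (IH i0.+1 _); last by lia.
  have i0n : i0 < n by lia.
  have := mode_step jn i0n; have [->|nj] := eqVneq j n.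
    move=> _; rewrite /t subnn (@exp0n (n - i0)); last by rewrite subn_gt0.
    by rewrite mul0n muln0.
  move=> E; have p0 : 0 < i0.+1 * (n - j) by rewrite muln_gt0; lia.
  rewrite -(leq_pmul2l p0) -E leq_mul2r; apply/orP; right; nia.
have down d i0 : i0 = j + d -> i0 <= n -> t n j i0 <= t n j j.
  elim: d i0 => [|d IH] i0 e h; first by rewrite e addn0.
  apply: leq_trans (IH i0.-1 _ _); try by lia.
  have i0n : i0.-1 < n by lia.
  have := mode_step jn i0n; rewrite prednK; last by lia.
  have [->|j0] := posnP j.
    move=> _; rewrite /t (@exp0n i0); last by lia.
    by rewrite !muln0.
  move=> E; have p0 : 0 < (n - i0.-1) * j by rewrite muln_gt0; lia.
  rewrite -(leq_pmul2l p0) E leq_mul2r; apply/orP; right; nia.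
have [ij|ji] := leqP i j; first by apply: (up (j - i)); lia.
by apply: (down (i - j)); lia.
Qed.

Lemma mode_bound n j : j <= n ->
  (expn n n <= n.+1 * ('C(n, j) * (expn (n - j) (n - j) * expn j j)))%N.
Proof.
move=> jn; have -> : expn n n = \sum_(i < n.+1) t n j i by rewrite -{1}(subnK jn) expnDn.
rewrite -[X in _ <= X * _](card_ord n.+1) -sum_nat_const.
by apply: leq_sum => i _; apply: mode_max => //; rewrite -ltnS.
Qed.
End NatBinomial.

(** * Binomial coefficients near the mean *)

Section Entropy.
Local Open Scope R_scope.

Lemma INR_expn a n : INR (expn a n) = INR a ^ n.
Proof. by elim: n => [|n IH] //; rewrite expnS INR_muln IH. Qed.

Lemma Rabs_bounds x a : Rabs x <= a -> - a <= x <= a.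
Proof. by split_Rabs; lra. Qed.

Lemma ln_neg x : 0 < x < 1 -> ln x < 0.
Proof. by move=> x01; rewrite -ln_1; apply: ln_increasing; lra. Qed.

Lemma exp_monotone x y : x <= y -> exp x <= exp y.
Proof. by case=> [/exp_increasing|->]; lra. Qed.

Lemma exp_ge1 x : 0 <= x -> 1 <= exp x.
Proof. by move=> /exp_monotone; rewrite exp_0. Qed.

Lemma exp_pow x n : exp x ^ n = exp (INR n * x).
Proof.
elim: n => [|n IH]; first by rewrite /= Rmult_0_l exp_0.
by rewrite -[LHS]/(exp x * exp x ^ n) IH -exp_plus S_INR; congr exp; ring.
Qed.

Lemma pow_exp_ln x n : 0 < x -> x ^ n = exp (INR n * ln x).
Proof. by move=> x0; rewrite -exp_pow exp_ln. Qed.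

(** From 1 + x <= exp x at x = a/b - 1. *)
Lemma pow_le_exp a b n : 0 <= a -> 0 < b -> a ^ n <= b ^ n * exp (INR n * (a / b - 1)).
Proof.
move=> a0 b0; rewrite -exp_pow -Rpow_mult_distr; apply: pow_incr; split=> //.
have h := exp_ineq1_le (a / b - 1).
apply: (Rle_trans _ (b * (1 + (a / b - 1)))); first by right; field; lra.
by apply: Rmult_le_compat_l; lra.
Qed.

Variable beta : R.
Hypothesis beta01 : 0 < beta < 1.

Lemma Phi0_pow n : Phi0 beta ^ n =
  exp (- INR n * (beta * ln beta + (1 - beta) * ln (1 - beta))).
Proof.
rewrite /Phi0 /Rpower -exp_plus -exp_Ropp exp_pow; congr exp; ring.
Qed.

Lemma Phi0_ge1 : 1 <= Phi0 beta.
Proof.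
have := Phi0_pow 1; rewrite pow_1 => ->; apply: exp_ge1.
have l1 : ln beta < 0 by apply: ln_neg; lra.
have l2 : ln (1 - beta) < 0 by apply: ln_neg; lra.
by rewrite /=; nra.
Qed.

Definition weight n j := (1 - beta) ^ (n - j)%N * beta ^ j.

Lemma weight_gt0 n j : 0 < weight n j.
Proof. by apply: Rmult_lt_0_compat; apply: pow_lt; lra. Qed.

(** [Phi0 beta ^ n] is the inverse of the weight at the mean j = beta n, so their product depends
    only on the deviation from the mean and is bounded above and below when the deviation is. *)
Lemma weight_Phi0 n j : (j <= n)%N -> weight n j * Phi0 beta ^ n =
  exp ((INR j - beta * INR n) * (ln beta - ln (1 - beta))).
Proof.
move=> jn; rewrite Phi0_pow /weight (@pow_exp_ln (1 - beta)) 1?(@pow_exp_ln beta); try lra.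
rewrite -!exp_plus; congr exp; rewrite minus_INR; last exact/leP.
ring.
Qed.

(** [mode_bound] is the same estimate with j/n in place of beta. Replacing j by beta n and n-j by
    (1-beta) n costs, by [pow_le_exp], the exponential of d^2 / (n beta (1-beta)) with d = j - beta
    n, and this is bounded because d is. *)
Lemma binomial_weight_lower n j D : (0 < n)%N -> (j <= n)%N ->
  Rabs (INR j - beta * INR n) <= D ->
  1 <= INR n.+1 * INR 'C(n, j) * weight n j * exp (D * D / (beta * (1 - beta))).
Proof.
move=> n0 jn hD; have N1 : 1 <= INR n by have := leq_INR n0.
have := leq_INR (mode_bound jn); rewrite !INR_muln !INR_expn => mb.
have e1 : INR (n - j)%N = INR n - INR j by rewrite minus_INR //; apply/leP.
have p1 := @pow_le_exp (INR (n - j)%N) ((1 - beta) * INR n) (n - j) (INR_ge0 _) ltac:(nra).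
have p2 := @pow_le_exp (INR j) (beta * INR n) j (INR_ge0 _) ltac:(nra).
have C0 := INR_ge0 'C(n, j); have N0 := INR_ge0 n.+1.
have np : 0 < INR n ^ n by apply: pow_lt; lra.
have a0 : 0 <= INR (n - j)%N ^ (n - j)%N by apply: pow_le; apply: INR_ge0.
have b0 : 0 <= INR j ^ j by apply: pow_le; apply: INR_ge0.
have ab := Rmult_le_compat _ _ _ _ a0 b0 p1 p2.
set k := _ * exp _ in ab.
have kE : k * (((beta * INR n) ^ j * exp (INR j * (INR j / (beta * INR n) - 1)))) =
  INR n ^ n * (weight n j * exp ((INR j - beta * INR n) * (INR j - beta * INR n) / (INR n * beta * (1 - beta)))).
  have -> : INR n ^ n = INR n ^ (n - j)%N * INR n ^ j.
    by rewrite -pow_add; congr pow; rewrite plusE subnK.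
  rewrite /k !Rpow_mult_distr /weight.
  rewrite (_ : _ / (INR n * beta * (1 - beta)) = INR (n - j)%N * (INR (n - j)%N / ((1 - beta) * INR n) - 1) + INR j * (INR j / (beta * INR n) - 1)).
    by rewrite exp_plus; ring.
  rewrite e1; field; lra.
rewrite kE in ab.
set d := (INR j - beta * INR n) in hD ab *.
have dd : d * d / (INR n * beta * (1 - beta)) <= D * D / (beta * (1 - beta)).
  have : d * d <= D * D.
    have := Rabs_pos d; have -> : d * d = Rabs d * Rabs d by rewrite -Rabs_mult Rabs_pos_eq //; nra.
    nra.
  move=> h; have q0 : 0 < beta * (1 - beta) by nra.
  apply: (Rmult_le_reg_r (INR n * (beta * (1 - beta)))); first by nra.
  have -> : d * d / (INR n * beta * (1 - beta)) * (INR n * (beta * (1 - beta))) = d * d by field; lra.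
  have -> : D * D / (beta * (1 - beta)) * (INR n * (beta * (1 - beta))) = D * D * INR n by field; lra.
  nra.
have ee : exp (d * d / (INR n * beta * (1 - beta))) <= exp (D * D / (beta * (1 - beta))).
  exact: exp_monotone.
have w0 := weight_gt0 n j.
apply: (Rmult_le_reg_l (INR n ^ n)) => //; rewrite Rmult_1_r.
apply: (Rle_trans _ _ _ mb).
have CN : 0 <= INR n.+1 * INR 'C(n, j) by apply: Rmult_le_pos.
apply: (Rle_trans _ (INR n.+1 * INR 'C(n, j) * (INR n ^ n * (weight n j * exp (D * D / (beta * (1 - beta))))))); last by right; ring.
rewrite -Rmult_assoc; apply: Rmult_le_compat_l => //; apply: (Rle_trans _ _ _ ab).
apply: Rmult_le_compat_l; first by lra.
by apply: Rmult_le_compat_l; lra.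
Qed.

(** The binomial coefficient times its weight is at most 1, as a term of (1-beta+beta)^n, and at
    least of order 1/(n+1) by [binomial_weight_lower]; [weight_Phi0] trades the weight for
    [Phi0]. *)
Lemma binomial_entropy_bounds D : exists M, 1 <= M /\ forall n j, (j <= n)%N ->
  Rabs (INR j - beta * INR n) <= D ->
  INR 'C(n, j) <= M * Phi0 beta ^ n /\ Phi0 beta ^ n <= M * INR n.+1 * INR 'C(n, j).
Proof.
pose lam := Rabs (ln beta - ln (1 - beta)).
pose D' := Rmax D 0.
pose M1 := exp (D' * lam); pose M2 := exp (D * D / (beta * (1 - beta))).
have lam0 : 0 <= lam by apply: Rabs_pos.
have D0 : 0 <= D' by apply: Rmax_r.
have DD : D <= D' by apply: Rmax_l.
have m1 : 1 <= M1.
  by apply: exp_ge1; nra.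
have m2 : 1 <= M2.
  by apply: exp_ge1; apply: Rmult_le_pos; [nra|left; apply: Rinv_0_lt_compat; nra].
exists (M1 * M2); split=> [|n j jn hD]; first by nra.
have hE := weight_Phi0 jn.
set x := (INR j - beta * INR n) in hD hE.
have xb : - (D' * lam) <= x * (ln beta - ln (1 - beta)) <= D' * lam.
  have : Rabs (x * (ln beta - ln (1 - beta))) <= D' * lam.
    by rewrite Rabs_mult; apply: Rmult_le_compat; try apply: Rabs_pos; rewrite /lam; lra.
  by move=> /Rabs_bounds; lra.
have w0 := weight_gt0 n j; have C0 := INR_ge0 'C(n, j).
have F0 : 0 < Phi0 beta ^ n by apply: pow_lt; have := Phi0_ge1; lra.
have up : weight n j * Phi0 beta ^ n <= M1.
  by rewrite hE; apply: exp_monotone; lra.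
have lo : 1 <= M1 * (weight n j * Phi0 beta ^ n).
  by rewrite hE -exp_plus; apply: exp_ge1; lra.
split.
  have := @bterm_le (1 - beta) beta n j ltac:(lra) ltac:(lra) jn.
  rewrite (_ : 1 - beta + beta = 1) ?pow1 /bterm -/(weight n j); last by ring.
  move=> h; apply: (Rle_trans _ (INR 'C(n, j) * (M1 * (weight n j * Phi0 beta ^ n)))).
    nra.
  rewrite (_ : _ * (M1 * _) = (INR 'C(n, j) * weight n j) * (M1 * Phi0 beta ^ n)); last by ring.
  have : 0 < M1 * Phi0 beta ^ n by nra.
  have : 0 <= (M2 - 1) * (M1 * Phi0 beta ^ n) by nra.
  nra.
case: (posnP n) => [n0|n0].
  move: jn; rewrite n0 leqn0 => /eqP ->; rewrite bin0 /=; nra.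
have := binomial_weight_lower n0 jn hD; rewrite -/M2 => h.
have N0 := INR_ge0 n.+1.
apply: (Rle_trans _ ((INR n.+1 * INR 'C(n, j) * weight n j * M2) * Phi0 beta ^ n)).
  nra.
rewrite (_ : _ * Phi0 beta ^ n = (INR n.+1 * INR 'C(n, j) * M2) * (weight n j * Phi0 beta ^ n)); last by ring.
rewrite (_ : M1 * M2 * _ * _ = (INR n.+1 * INR 'C(n, j) * M2) * M1); last by ring.
apply: Rmult_le_compat_l => //; apply: Rmult_le_pos; [exact: Rmult_le_pos|lra].
Qed.
End Entropy.

(** * Asymptotics *)

Section Asymptotics.
Local Open Scope R_scope.

Lemma wcount_chunks w D i n N : (forall n i j, (wcount w i n <= wcount w j n + D)%N) ->
  (N * wcount w i n <= wcount w 0 (N * n) + N * D)%N /\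
  (wcount w 0 (N * n) <= N * (wcount w i n + D))%N.
Proof.
move=> bal; elim: N => [|N [IH1 IH2]]; first by rewrite !mul0n wcount0.
rewrite (mulSnr _ n) wcountD; have := bal n i (0 + N * n)%N; have := bal n (0 + N * n)%N i.
nia.
Qed.

(** If one window deviated from [alpha n] by more than [D], then by balance every window of that
    length would deviate in the same direction. Tiling long prefixes by such windows would keep
    their densities away from [alpha] by the amount fixed in [ep]. *)
Lemma balanced_slope w D alpha : (forall n i j, (wcount w i n <= wcount w j n + D)%N) ->
  slope_is w alpha -> forall i n, Rabs (INR (wcount w i n) - alpha * INR n) <= INR D.
Proof.
move=> bal sl i n; case: (posnP n) => [->|n0].
  by rewrite wcount0 /= Rmult_0_r Rminus_0_r Rabs_R0; apply: INR_ge0.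
apply: Rnot_lt_le => lt.
have np : 0 < INR n by apply: lt_0_INR; apply/ltP.
set c := INR (wcount w i n) in lt.
have ep : 0 < (Rabs (c - alpha * INR n) - INR D) / INR n.
  by apply: Rdiv_lt_0_compat; lra.
have [N0 hN] := sl _ ep.
pose N := N0.+1; pose k := (N * n)%N.
have kN : (k >= N0)%coq_nat by apply/leP; rewrite /k /N; nia.
have := hN k kN; rewrite /Rdist.
have -> : (\sum_(l < k) (w l : nat))%N = wcount w 0 k by [].
have Np : 0 < INR N by apply: lt_0_INR; apply/ltP.
have kE : INR k = INR N * INR n by rewrite /k INR_muln.
have [c1 c2] := wcount_chunks i n N bal; rewrite -/k in c1 c2.
move: c1 c2 => /leq_INR; rewrite INR_addn !INR_muln -/c => c1 /leq_INR.
rewrite INR_muln INR_addn -/c => c2.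
set W := INR (wcount w 0 k) in c1 c2 *.
move=> h.
have kp : 0 < INR k by rewrite kE; nra.
have h' : Rabs (W - alpha * INR k) < INR N * (Rabs (c - alpha * INR n) - INR D).
  have -> : W - alpha * INR k = (W / INR k - alpha) * INR k by field; lra.
  rewrite Rabs_mult (Rabs_pos_eq (INR k)); last by lra.
  have -> : INR N * (Rabs (c - alpha * INR n) - INR D) =
     (Rabs (c - alpha * INR n) - INR D) / INR n * INR k by rewrite kE; field; lra.
  by rewrite -kE in h; apply: Rmult_lt_compat_r.
rewrite kE in h'.
have : INR N * Rabs (c - alpha * INR n) <= Rabs (W - alpha * (INR N * INR n)) + INR N * INR D.
  rewrite -{1}(Rabs_pos_eq (INR N)); last by lra.
  rewrite -Rabs_mult; have -> : INR N * (c - alpha * INR n) = (W - alpha * (INR N * INR n)) + (INR N * c - W) by ring.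
  apply: Rle_trans (Rabs_triang _ _) _; apply: Rplus_le_compat_l; apply: Rabs_le; lra.
lra.
Qed.

Lemma slope_ge0 w alpha : slope_is w alpha -> 0 <= alpha.
Proof.
move=> sl; apply: Rnot_lt_le => a0; have [N hN] := sl (- alpha) ltac:(lra).
have := hN N.+1 ltac:(lia); rewrite /Rdist.
have : 0 <= INR (\sum_(l < N.+1) (w l : nat))%N / INR N.+1.
  apply: Rmult_le_pos; first exact: INR_ge0.
  by left; apply: Rinv_0_lt_compat; apply: lt_0_INR; lia.
set x := _ / _ => x0 h.
by have : Rabs (x - alpha) < - alpha by []; split_Rabs; lra.
Qed.

Lemma bcount_sub_le m w p l : (bcount m w (p + l) - bcount m w p <= l)%N.
Proof.
elim: l => [|l IH]; first by rewrite addn0 subnn.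
by rewrite addnS bcountS; case: (blockend _ _ _); lia.
Qed.

(** If [d] blocks end in the factor, its length is m d plus the number of ones in [d] letters of
    [w], up to m+1 for the incomplete blocks at the two ends. Balance replaces that number by alpha
    d up to [D]. *)
Lemma bcount_discrepancy m w alpha D p l : (2 <= m)%N -> 0 <= alpha ->
  (forall i n, Rabs (INR (wcount w i n) - alpha * INR n) <= D) ->
  Rabs (INR (bcount m w (p + l) - bcount m w p)%N - / (INR m + alpha) * INR l) <= INR m + 1 + D.
Proof.
move=> m2 a0 bal; have [d e] := bcountD m w p l; rewrite e addKn.
have /andP[h1 h2] := bcount_bounds w m2 p; have /andP[h3 h4] := bcount_bounds w m2 (p + l).
have mR : 2 <= INR m by have := leq_INR m2; rewrite /=; lra.
rewrite e in h3 h4; set i := bcount m w p in h1 h2 h3 h4.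
have wi b : (w b <= 1)%N by case: (w b).
have b1 : (m * d + wcount w i d <= l + m.+1)%N.
  by move: h1 h2 h3; rewrite KpartS KpartD; have := wi i; lia.
have b2 : (l <= m * d + wcount w i d + m.+1)%N.
  by move: h1 h4; rewrite KpartS KpartD; have := wi (i + d)%N; lia.
move: b1 b2 => /leq_INR; rewrite !INR_addn INR_muln S_INR => b1 /leq_INR.
rewrite !INR_addn INR_muln S_INR => b2.
have /Rabs_bounds b3 := bal i d.
set b := / (INR m + alpha).
have b0 : 0 < b by apply: Rinv_0_lt_compat; lra.
have bE : b * (INR m + alpha) = 1 by rewrite /b; field; lra.
have bb : b <= 1 by nra.
have dE : INR d - b * INR l = b * ((INR m + alpha) * INR d - INR l).
  by rewrite -{1}[INR d]Rmult_1_l -bE; ring.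
have bnd : - (INR m + 1 + D) <= (INR m + alpha) * INR d - INR l <= INR m + 1 + D by lra.
have D0 : 0 <= D by apply: Rle_trans (bal 0%N 0%N); apply: Rabs_pos.
have x1 : - (INR m + 1 + D) <= b * ((INR m + alpha) * INR d - INR l) <= INR m + 1 + D.
  by split; nra.
by apply: Rabs_le; lra.
Qed.

Lemma ln_le x y : 0 < x -> x <= y -> ln x <= ln y.
Proof. by move=> x0 [/ln_increasing h|->]; [left; apply: h|lra]. Qed.

(** After taking logarithms the error is at most ln M + 2 ln(n+1), which is o(n). *)
Lemma nroot_cv (c : nat -> nat) L M : 0 < L ->
  (forall n, (3 <= n)%N -> L ^ n <= M * INR n.+1 ^ 2 * INR (c n) /\
                         INR (c n) <= M * INR n.+1 ^ 2 * L ^ n) ->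
  Un_cv (fun n => nroot n (INR (c n))) L.
Proof.
move=> L0 H.
have Mpos : 0 < M.
  have [h _] := H 3%N isT; have p : 0 < L ^ 3 by apply: pow_lt.
  have q : 0 <= INR 4 ^ 2 * INR (c 3%N).
    by apply: Rmult_le_pos; [apply: pow_le|]; apply: INR_ge0.
  by apply: Rnot_le_lt => M0; rewrite Rmult_assoc in h; nra.
have cpos n : (3 <= n)%N -> 0 < INR (c n).
  move=> n3; have [h _] := H n n3; have p : 0 < L ^ n by apply: pow_lt.
  have q : 0 <= M * INR n.+1 ^ 2 by apply: Rmult_le_pos; [lra|apply: pow_le; apply: INR_ge0].
  by apply: Rnot_le_lt => c0; nra.
pose g n := ln M + 2 * ln (INR n.+1).
have bounds n : (3 <= n)%N -> Rabs (ln (INR (c n)) - INR n * ln L) <= g n.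
  move=> n3; have [h1 h2] := H n n3; have cp := cpos n n3.
  have np : 0 < INR n.+1 by apply: lt_0_INR; lia.
  have n2p : 0 < INR n.+1 ^ 2 by apply: pow_lt.
  have Lp : 0 < L ^ n by apply: pow_lt.
  have gE : ln (M * INR n.+1 ^ 2) = g n by rewrite ln_mult // ln_pow //.
  have Mn : 0 < M * INR n.+1 ^ 2 by apply: Rmult_lt_0_compat.
  have le1 := ln_le Lp h1; have le2 := ln_le cp h2.
  rewrite ln_mult // gE ln_pow // in le1; rewrite ln_mult // gE ln_pow // in le2.
  by apply: Rabs_le; lra.
suff cvl : Un_cv (fun n => / INR n * ln (INR (c n))) (ln L).
  have := continuity_seq exp _ _ (derivable_continuous_pt _ _ (derivable_pt_exp (ln L))) cvl.
  by rewrite exp_ln.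
move=> eps e0.
(* With s = sqrt(n+1) one has ln(n+1) <= 2s, so it suffices that |ln M| + 4s + eps < eps s^2; for s
   > 1 this follows from A < eps s. *)
pose A := Rabs (ln M) + 4 + eps; have A0 : 0 < A by have := Rabs_pos (ln M); rewrite /A; lra.
pose s0 := Rmax 1 (A / eps + 1).
have [N hN] := INR_unbounded (s0 * s0).
exists (maxn N 3) => n nN.
have n3 : (3 <= n)%N by lia.
have nN' : INR N <= INR n by apply: leq_INR; lia.
have np : 0 < INR n by apply: lt_0_INR; lia.
rewrite /Rdist.
have -> : / INR n * ln (INR (c n)) - ln L = (ln (INR (c n)) - INR n * ln L) / INR n by field; lra.
rewrite Rabs_mult (Rabs_pos_eq (/ INR n)); last by left; apply: Rinv_0_lt_compat.
apply: (Rmult_lt_reg_r (INR n)) => //.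
rewrite Rmult_assoc Rinv_l ?Rmult_1_r; last by lra.
apply: Rle_lt_trans (bounds n n3) _.
pose s := sqrt (INR n.+1).
have n1 : INR n.+1 = INR n + 1 by rewrite S_INR.
have ss : s * s = INR n.+1 by apply: sqrt_sqrt; apply: INR_ge0.
have sp : 0 < s by apply: sqrt_lt_R0; lra.
have lns : ln (INR n.+1) <= 2 * s.
  rewrite -ss ln_mult //; have := exp_ineq1_le (ln s); rewrite exp_ln //; lra.
have ss0 : s0 < s.
  apply: Rsqr_incrst_0; rewrite /Rsqr; [|rewrite /s0; have := Rmax_l 1 (A / eps + 1); lra|lra].
  by rewrite ss; lra.
have s1 : 1 < s by apply: Rle_lt_trans ss0; apply: Rmax_l.
have s2 : A < eps * s.
  have : A / eps + 1 < s by apply: Rle_lt_trans ss0; apply: Rmax_r.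
  move=> h; have -> : A = eps * (A / eps) by field; lra.
  by apply: Rmult_lt_compat_l; lra.
have := Rle_abs (ln M); rewrite /g => h.
have : eps * INR n = eps * (s * s) - eps by rewrite ss n1; ring.
move=> ->; rewrite /A in s2.
have : (Rabs (ln M) + 4 + eps) * s < eps * s * s by apply: Rmult_lt_compat_r.
have := Rabs_pos (ln M); nra.
Qed.

Lemma has_PIexp_of_bounds (F : fieldType) (V : lmodType F) (mul : V -> V -> V) L M :
  0 < L -> (forall n, exists c, is_codim mul n c) ->
  (forall n c, (3 <= n)%N -> is_codim mul n c ->
     L ^ n <= M * INR n.+1 ^ 2 * INR c /\ INR c <= M * INR n.+1 ^ 2 * L ^ n) ->
  has_PIexp mul L.
Proof.
move=> L0 ex H.
pose c n := proj1_sig (constructive_indefinite_description _ (ex n)).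
have cP n : is_codim mul n (c n) := proj2_sig (constructive_indefinite_description _ (ex n)).
exists c; split=> //; apply: (@nroot_cv c L M L0) => n n3; exact: H.
Qed.

(** * Assembly of the bounds *)

Section Assembly.
Variables (F : fieldType) (m : nat) (w : nat -> bool) (beta D : R) (Q : nat).
Hypothesis beta01 : 0 < beta < 1.
Hypothesis disc : forall p l,
  Rabs (INR (bcount m w (p + l) - bcount m w p)%N - beta * INR l) <= D.
Hypothesis fact : forall n, exists s, (size s <= Q * n.+1)%N /\ covers_factors (blockend m w) n s.
Notation mulU := (@tmul F (tableAs m w)).
Notation mulA := (@tmul F (tableA m w)).
Notation Phi := (Phi0 beta).

Lemma blocks_in_le p k : (blocks_in m w p k <= k)%N.
Proof. by apply: leq_trans (bcount_sub_le _ _ _ _) (leq_pred _). Qed.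

Lemma has_indep0 (V : lmodType F) (mul : V -> V -> V) n : has_indep mul n 0.
Proof. by exists (fun _ => [::]); split=> [[]|lam _ []]. Qed.

Lemma codim_exists_As n : exists c, is_codim mulU n c.
Proof.
have [s [_ cov]] := fact n.
by have [c [? _ _]] := is_codim_exists (has_indep0 _ n) (@codim_upper_As F m w n s cov); exists c.
Qed.

Lemma codim_exists_A n : exists c, is_codim mulA n c.
Proof.
have [s [_ cov]] := fact n.
by have [c [? _ _]] := is_codim_exists (has_indep0 _ n) (@codim_upper_A F m w n s cov); exists c.
Qed.

Lemma reps_bound n e0 (TT : seq {set 'I_n}) s M : 1 <= M -> (size s <= Q * n.+1)%N ->
  (forall p k, INR 'C(k, blocks_in m w p k) <= M * Phi ^ k) ->
  exists a : {set 'I_n} -> nat, size (reps m w e0 TT s) = (\sum_(T <- TT) a T).+1 /\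
    forall T, INR (a T) <= INR Q * M * INR n.+1 ^ 2 * Phi ^ (n - #|T|)%N.
Proof.
move=> M1 sQ up; eexists; split; first exact: size_reps.
move=> T; cbv beta; rewrite INR_muln.
have h := @sum_const_le _ s (fun p => 'C(n - #|T|, blocks_in m w p (n - #|T|))) _ (fun p _ => up p _).
have /leq_INR := sQ; rewrite INR_muln => sR.
have n0 := INR_ge0 n; have nn : INR n <= INR n.+1 by rewrite S_INR; lra.
have Pp : 0 < Phi ^ (n - #|T|)%N by apply: pow_lt; have := Phi0_ge1 beta01; lra.
have s0 := INR_ge0 (size s).
set y := Phi ^ _ in Pp h *; have MP : 0 <= M * y by nra.
apply: (Rle_trans _ (INR n.+1 * (INR Q * INR n.+1 * (M * y)))); last by right; ring.
apply: Rmult_le_compat => //; first exact: INR_ge0.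
by apply: Rle_trans h _; apply: Rmult_le_compat_r.
Qed.

(** The extra 1 pays for comparing with k instead of the k-1 letters read, since beta < 1. *)
Lemma blocks_in_discrepancy p k : Rabs (INR (blocks_in m w p k) - beta * INR k) <= D + 1.
Proof.
have /Rabs_bounds h := disc p k.-1.
have h1 : INR k.-1 <= INR k by apply: leq_INR; apply: leq_pred.
have h2 : INR k <= INR k.-1 + 1 by rewrite -S_INR; apply: leq_INR; lia.
by apply: Rabs_le; rewrite /blocks_in; nra.
Qed.

Lemma binomial_bounds : exists M, [/\ 1 <= M,
  forall p k, INR 'C(k, blocks_in m w p k) <= M * Phi ^ k &
  forall k, Phi ^ k <= M * INR k.+1 * INR 'C(k, bcount m w k)].
Proof.
have [M [M1 HM]] := binomial_entropy_bounds beta01 (D + 1).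
exists M; split=> // [p k|k].
  exact: proj1 (HM k _ (blocks_in_le p k) (blocks_in_discrepancy p k)).
have := disc 0 k; have := bcount_sub_le m w 0 k.
rewrite add0n [X in (_ - X)%N]/bcount big_ord0 subn0 => h1 h2.
by apply: (HM k _ h1 _).2; lra.
Qed.

Lemma PIexp_A : has_PIexp mulA Phi.
Proof.
have P1 := Phi0_ge1 beta01; have [M [M1 up lo]] := binomial_bounds.
have Q0 := INR_ge0 Q.
(* The summand 1 accounts for [e0] and [INR Q * M] for the keys in the upper bound. [Phi * M] serves
   the lower bound, where only n-1 letters are read. *)
apply: (@has_PIexp_of_bounds _ _ _ _ (1 + INR Q * M + Phi * M)); [lra|exact: codim_exists_A|].
move=> n c n3 cod; have Pn : 1 <= Phi ^ n by apply: pow_R1_Rle.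
have n1 : 1 <= INR n.+1 by rewrite S_INR; have := INR_ge0 n; lra.
have n2 : INR n.+1 <= INR n.+1 ^ 2 by nra.
have c0 := INR_ge0 c; have QM : 0 <= INR Q * M by nra.
have PM : 0 <= Phi * M by nra.
split; last first.
  have [s [sQ cov]] := fact n.
  have /leq_INR := is_codim_le cod (@codim_upper_A F m w n s cov).
  have [a [-> ha]] := @reps_bound n (fun=> 1%N) [:: set0] s M M1 sQ up.
  rewrite big_seq1 S_INR; have := ha set0; rewrite cards0 subn0 => h1 h2.
  have x1 : 1 <= INR n.+1 ^ 2 * Phi ^ n by nra.
  have : 0 <= Phi * M * (INR n.+1 ^ 2 * Phi ^ n) by nra.
  nra.
case: n n3 cod Pn n1 n2 => [//|n'] n3 cod Pn n1 n2.
have /leq_INR hc := is_codim_ge cod (@has_indep_A F m w n' ltac:(lia)).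
have nn : INR n'.+1 <= INR n'.+2 by apply: leq_INR.
have x1 : Phi * (M * INR n'.+1 * INR 'C(n', bcount m w n')) <= Phi * (M * INR n'.+2 * INR c).
  apply: Rmult_le_compat_l; first by lra.
  by apply: Rmult_le_compat => //; [apply: Rmult_le_pos; [lra|exact: INR_ge0]|exact: INR_ge0|apply: Rmult_le_compat_l; lra].
have x2 : Phi ^ n'.+1 <= Phi * M * (INR n'.+2 * INR c).
  rewrite -[Phi ^ _]/(Phi * Phi ^ n').
  have := @Rmult_le_compat_l Phi _ _ ltac:(lra) (lo n'); lra.
have x3 : INR n'.+2 * INR c <= INR n'.+2 ^ 2 * INR c by apply: Rmult_le_compat_r.
have x4 : 0 <= INR n'.+2 ^ 2 * INR c by nra.
nra.
Qed.

Lemma PIexp_As : has_PIexp mulU (1 + Phi).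
Proof.
have P1 := Phi0_ge1 beta01; have [M [M1 up lo]] := binomial_bounds.
have Q0 := INR_ge0 Q.
apply: (@has_PIexp_of_bounds _ _ _ _ (1 + INR Q * M + Phi * M)); [lra|exact: codim_exists_As|].
move=> n c n3 cod; have Pn : 1 <= (1 + Phi) ^ n by apply: pow_R1_Rle; lra.
have n1 : 1 <= INR n.+1 by rewrite S_INR; have := INR_ge0 n; lra.
have n2 : INR n.+1 <= INR n.+1 ^ 2 by nra.
have c0 := INR_ge0 c; have QM : 0 <= INR Q * M by nra.
have PM : 0 <= Phi * M by nra.
split; last first.
  have [s [sQ cov]] := fact n.
  have /leq_INR := is_codim_le cod (@codim_upper_As F m w n s cov).
  have [a [-> ha]] := @reps_bound n (fun=> 0%N) (enum {set 'I_n}) s M M1 sQ up.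
  rewrite S_INR; have := sum_sets_le ha => h1 h2.
  move: ((1 + Phi) ^ n) Pn h1 => y Pn h1.
  have x1 : 1 <= INR n.+1 ^ 2 * y by nra.
  have : 0 <= Phi * M * (INR n.+1 ^ 2 * y) by nra.
  by have := Rle_trans _ _ _ h2 (Rplus_le_compat_r 1 _ _ h1); lra.
(* k is the index of the largest term of [(1 + Phi) ^ n]. The commutators need k >= 2; a maximum at
   0 or 1 may be replaced by the term at 2, because 'C(n, 2) >= n for n >= 3 and [Phi] is at least
   1. *)
have [k /andP[k2 kn] hk] : exists2 k, (1 < k <= n)%N &
    (1 + Phi) ^ n <= INR n.+1 * (INR 'C(n, k) * Phi ^ k).
  have [k kn hk] := bterm_max 1 Phi n.
  rewrite /bterm pow1 Rmult_1_l in hk.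
  have [k1|k1] := ltnP 1 k; first by exists k; rewrite ?k1.
  exists 2%N; first by lia.
  apply: Rle_trans hk _; apply: Rmult_le_compat_l; first by lra.
  have c2 : INR n <= INR 'C(n, 2) by apply: leq_INR; rewrite bin2; nia.
  have nR : 3 <= INR n by have := leq_INR n3; rewrite /=; lra.
  have [->|->] : k = 0%N \/ k = 1%N by lia.
    by rewrite bin0 /=; nra.
  rewrite bin1 pow_1; apply: Rmult_le_compat; [exact: INR_ge0|lra|exact: c2|nra].
case: n n3 cod Pn n1 n2 kn hk => [//|n'] n3 cod Pn n1 n2 kn hk.
have /leq_INR hc := is_codim_ge cod (@has_indep_As F m w n' k ltac:(lia)).
case: k k2 kn hk hc => [//|k'] k2 kn hk hc.
rewrite INR_muln /= -/('C(_, _)) in hc.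
have nn : INR k'.+1 <= INR n'.+2 by apply: leq_INR; lia.
have C0 := INR_ge0 'C(n'.+1, k'.+1); have B0 := INR_ge0 'C(k', bcount m w k').
have x1 : Phi ^ k'.+1 <= Phi * M * (INR n'.+2 * INR 'C(k', bcount m w k')).
  rewrite -[Phi ^ _]/(Phi * Phi ^ k').
  have : M * INR k'.+1 * INR 'C(k', bcount m w k') <= M * (INR n'.+2 * INR 'C(k', bcount m w k')).
    by rewrite Rmult_assoc; apply: Rmult_le_compat_l; [lra|apply: Rmult_le_compat_r].
  have := lo k'; nra.
have x2 : INR 'C(n'.+1, k'.+1) * Phi ^ k'.+1 <= Phi * M * (INR n'.+2 * INR c).
  apply: (Rle_trans _ (INR 'C(n'.+1, k'.+1) * (Phi * M * (INR n'.+2 * INR 'C(k', bcount m w k'))))).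
    exact: Rmult_le_compat_l.
  apply: (Rle_trans _ (Phi * M * INR n'.+2 * (INR 'C(n'.+1, k'.+1) * INR 'C(k', bcount m w k')))).
    by right; ring.
  rewrite [X in _ <= X](_ : _ = Phi * M * INR n'.+2 * INR c); last by ring.
  by apply: Rmult_le_compat_l => //; apply: Rmult_le_pos; lra.
have x3 : (1 + Phi) ^ n'.+1 <= Phi * M * (INR n'.+2 ^ 2 * INR c).
  apply: Rle_trans hk _.
  apply: (Rle_trans _ (INR n'.+2 * (Phi * M * (INR n'.+2 * INR c)))).
    by apply: Rmult_le_compat_l; lra.
  by right; ring.
have x4 : 0 <= INR n'.+2 ^ 2 * INR c by nra.
nra.
Qed.

End Assembly.

End Asymptotics.

Theorem theorem1 (F : fieldType) (HF : GRing.pchar F =i pred0)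
    (m : nat) (w : nat -> bool) (alpha : R) :
  2 <= m ->
  (sturmian w \/ (periodic w /\ nonzero_word w)) ->
  slope_is w alpha ->
  has_PIexp (@tmul F (tableAs m w)) (1 + Phi0 (/ (INR m + alpha)))%R /\
  has_PIexp (@tmul F (tableA m w)) (Phi0 (/ (INR m + alpha)))%R.
Proof.
move=> m2 hw sl; have a0 := slope_ge0 sl.
have [D bal] : exists D, forall n i j, (wcount w i n <= wcount w j n + D)%N.
  case: hw => [st|[per _]]; last exact: periodic_balanced.
  by exists 1%N => n i j; rewrite addn1; apply: sturmian_balanced.
have disc p l := bcount_discrepancy p l m2 a0 (balanced_slope bal sl).
have [Q fact] : exists Q, forall n, exists s,
    (size s <= Q * n.+1)%N /\ covers_factors (blockend m w) n s.
  have [Q hQ] : exists Q, forall n, exists s, (size s <= Q * n.+1)%N /\ covers_factors w n s.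
    case: hw => [st|[per _]].
      exists 1%N => n; have [s [h1 h2]] := sturmian_representatives st n.
      by exists s; rewrite mul1n.
    have [q hq] := periodic_representatives per; exists q => n.
    by have [s [h1 h2]] := hq n; exists s; split=> //; nia.
  (* Factors of [w] of length n+m+1 have at most Q (n+m+2) <= Q (m+2)(n+1) representatives, and each
     is combined with m+1 offsets. *)
  exists (Q * m.+2 * m.+1)%N => n; have [s [h1 h2]] := hQ (n + m).+1.
  have [s' [h3 h4]] := blockend_representatives m2 h2.
  by exists s'; split=> //; rewrite h3; nia.
have mR : (2 <= INR m)%R by have := leq_INR m2; rewrite /=; lra.
have b01 : (0 < / (INR m + alpha) < 1)%R.
  split; first by apply: Rinv_0_lt_compat; lra.
  by rewrite -Rinv_1; apply: Rinv_lt_contravar; lra.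
by split; [apply: PIexp_As b01 disc fact|apply: PIexp_A b01 disc fact].
Qed.
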